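(* There exist initial data $u_0 \in L^\infty(\mathbb{R})$ for Burgers' equation such that $$\omega_0(u_0) \,\supset\, \bigl\{\Psi_\gamma \,;\, \gamma > 0\bigr\} \,\cup\, \bigl\{\phi_{\delta,-\delta}\,;\,\delta \in [0,2]\bigr\}\,,$$ where $$\Psi_\gamma(x) = \frac{-2\sinh(x)}{\gamma + \cosh(x)}\,,\qquad \phi_{\delta,-\delta}(x) = -\delta\tanh\Bigl(\frac{\delta x}{2}\Bigr)\,,\qquad x\in\mathbb{R}\,.$$ In particular $\omega_0(u_0) \not\subset \Sigma$, where $\Sigma$ is the collection of all translates of all viscous shocks of Burgers' equation, including the constants.
   Context: Burgers' equation is $\partial_t u+u\,\partial_x u=\partial_x^2 u$ for $t>0$, $x\in\mathbb{R}$. For $u_0\in L^\infty(\mathbb{R})$, $\mathcal{S}_t(u_0)=u(t,\cdot)$ denotes the unique global solution $u\in C^0((0,+\infty),L^\infty(\mathbb{R}))$ with $u(t,\cdot)\to u_0$ weak-$*$ in $L^\infty(\mathbb{R})$ as $t\to0+$. The $\omega$-limit set in the fixed frame is $$\omega_0(u_0)=\{v\in L^\infty(\mathbb{R}) \mid \exists\, t_k\to+\infty \text{ such that } \mathcal{S}_{t_k}(u_0)\to v \text{ in } L^\infty_{\mathrm{loc}}(\mathbb{R})\},$$ where convergence in $L^\infty_{\mathrm{loc}}(\mathbb{R})$ is uniform convergence on compact intervals. For $\beta\ge\alpha$ let $\phi_{\beta,\alpha}(y)=c-\delta\tanh(\delta y/2)$ with $c=(\alpha+\beta)/2$, $\delta=(\beta-\alpha)/2$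 (a constant if $\alpha=\beta$), let $(\mathcal{T}_y u)(x)=u(x-y)$, and let $$\Sigma=\bigcup_{\beta\ge\alpha}\bigcup_{y\in\mathbb{R}}\{\mathcal{T}_y\phi_{\beta,\alpha}\}.$$ *)

(* Defs.v *)
From mathcomp Require Import all_boot all_order all_algebra.
From mathcomp Require Import all_classical all_reals all_analysis.

Set Implicit Arguments.
Unset Strict Implicit.
Unset Printing Implicit Defensive.
Import Order.TTheory GRing.Theory Num.Theory.
Import numFieldNormedType.Exports.

Local Open Scope classical_set_scope.
Local Open Scope ring_scope.

Definition cosh (R : realType) (x : R) : R := (expR x + expR (- x)) / 2.

Definition sinh (R : realType) (x : R) : R := (expR x - expR (- x)) / 2.

Definition tanh (R : realType) (x : R) : R := sinh x / cosh x.

Definition Linfty (R : realType) : set (R -> R) :=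
  [set f | f \in Lfun (@lebesgue_measure R) +oo%E].

Definition weak_star_cvg0 (R : realType) (u : R -> R -> R) (u0 : R -> R) :=
  forall g : R -> R,
    (@lebesgue_measure R).-integrable [set: R] (EFin \o g) ->
    (\int[lebesgue_measure]_(x in [set: R]) (u t x * g x) @[t --> 0^'+]
       --> \int[lebesgue_measure]_(x in [set: R]) (u0 x * g x))%R.

(* Solutions are smooth for t > 0 by parabolic regularity, so the equation is
   understood in the classical C^{1,2} sense; as a consequence [u t] is the
   continuous representative of its class in L^oo.  Nothing is said about
   [u t] for t <= 0. *)
Record burgers_solution (R : realType) (u0 : R -> R) (u : R -> R -> R) : Prop :=
  BurgersSolution {
    burgers_derivable_t : forall t x : R, 0 < t -> derivable (u ^~ x) t 1;
    burgers_derivable_x : forall t x : R, 0 < t -> derivable (u t) x 1;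
    burgers_derivable_xx : forall t x : R, 0 < t -> derivable (derive1 (u t)) x 1;
    burgers_continuous : forall p : R * R, 0 < p.1 ->
      [/\ {for p, continuous (fun q : R * R => u q.1 q.2)},
          {for p, continuous (fun q : R * R => derive1 (u ^~ q.2) q.1)},
          {for p, continuous (fun q : R * R => derive1 (u q.1) q.2)} &
          {for p, continuous (fun q : R * R => derive1 (derive1 (u q.1)) q.2)}];
    burgers_eq : forall t x : R, 0 < t ->
      derive1 (u ^~ x) t + u t x * derive1 (u t) x = derive1 (derive1 (u t)) x;
    burgers_Linfty : forall t : R, 0 < t -> Linfty (u t);
    burgers_Linfty_continuous : forall t : R, 0 < t ->
      'N[lebesgue_measure]_+oo[(fun x => (u s x - u t x)%:E)]%E @[s --> t]
        --> 0%E;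
    burgers_initial : weak_star_cvg0 u u0 }.

(* The Cauchy problem is well posed in L^oo, and a solution is unique for
   t > 0; [burgers_flow u0 t] is S_t(u0), and is only meaningful for
   [Linfty u0] and [0 < t]. *)
Definition burgers_flow (R : realType) (u0 : R -> R) : R -> R -> R :=
  xget (fun _ _ => 0) [set u | burgers_solution u0 u].

(* Elements of L^oo are represented by functions.  The convergence is uniform
   at every point of a compact interval, not merely up to a null set: S_t(u0)
   is continuous, so only the continuous representative of a limit class
   belongs to [omega0 u0]. *)
Definition omega0 (R : realType) (u0 : R -> R) : set (R -> R) :=
  [set v | Linfty v /\
    exists t_ : nat -> R, t_ @ \oo --> +oo /\
      forall a b : R,
        {uniform `[a, b], (fun k => burgers_flow u0 (t_ k)) @ \oo --> v}].

Definition translate (R : realType) (y : R) (f : R -> R) : R -> R :=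
  fun x => f (x - y).

Definition phi (R : realType) (beta alpha : R) : R -> R := fun y =>
  let c := (alpha + beta) / 2 in
  let delta := (beta - alpha) / 2 in
  c - delta * tanh (delta * y / 2).

Definition Sigma (R : realType) : set (R -> R) :=
  [set v | exists beta alpha y, alpha <= beta /\ v = translate y (phi beta alpha)].

Definition Psi (R : realType) (gamma : R) : R -> R := fun x =>
  - 2 * sinh x / (gamma + cosh x).

Lemma phi_opp (R : realType) (delta x : R) :
  phi delta (- delta) x = - delta * tanh (delta * x / 2).
Proof.
by rewrite /phi addNr mul0r sub0r opprK mulrDl -splitr mulNr.
Qed.

(* Main.v *)
Require Import Defs.
From mathcomp Require Import all_boot all_order all_algebra.
From mathcomp Require Import all_classical all_reals all_analysis.
From mathcomp Require Import measurable_realfun ess_sup_inf ring lra.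

(** The Cole-Hopf substitution u = -2 w_x / w turns positive solutions w of the
    heat equation into solutions of Burgers' equation, so it is enough to find a
    w whose large-time behaviour near the origin is sufficiently erratic.  Fix
    scales growing like tau_(n+1) = exp (8 tau_n) and let
      w(0,x) = 1 + sum over n of a pair of Gaussians centred at +4 tau_n and
               -4 tau_n, of variance comparable to tau_n, amplified by
               exp (2 tau_n).
    The heat flow of such data is explicit: only the width of each Gaussian
    changes.  When the width parameter of the n-th pair reaches s = 2 tau_n / k,
    completing the square shows that on bounded sets this pair contributes
      2 A cosh (k x),   A = sqrt (k / 2) exp (2 tau_n (1 - k)),
    up to a factor tending to 1 ([main_term0]).  The earlier pairs have been
    flattened by then and the later ones are still too far away ([rest_bound]),
    so that u is close to
      - 2 k sinh (k x) / (p + cosh (k x)),   p = 1 / (2 A)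
    ([window_cvg]).  Near k = 1 the weight p passes from 0 to infinity: letting k
    tend to 1 at distance of order 1 / tau_n makes p converge to any prescribed
    gamma > 0 and yields Psi_gamma, while remaining below 1 at a larger distance
    forces p to 0 and yields the shock -2 k tanh (k x), which is
    phi_(delta,-delta) for delta = 2 k.

    The flow is an arbitrarily chosen solution of the Cauchy problem, so the
    explicit u has to be shown to be the only one ([burgers_unique]).  Weak-*
    convergence at t = 0 bounds any solution uniformly for small times: this is
    the uniform boundedness principle for functionals on L^1, obtained by a
    gliding hump ([gliding_hump], [weak_star_bounded]).  For two solutions u and
    v the potential E(t,x), the integral of u - v from 0 to x, then grows at most
    linearly in x, tends to 0 with t, and satisfies, up to a function of time
    alone, a linear parabolic equation with bounded drift (u + v) / 2.
    Comparison with a quadratic barrier ([parabolic_comparison]) gives E = 0.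

    Finally Psi_1(x) = -2 tanh (x/2) is not a translated shock, because each shock
    solves a Riccati equation 2 f' = (f - c)^2 - d^2 that Psi_1 violates. *)

Set Implicit Arguments.
Unset Strict Implicit.
Unset Printing Implicit Defensive.
Import Order.TTheory GRing.Theory Num.Theory.
Import numFieldNormedType.Exports.

Local Open Scope classical_set_scope.
Local Open Scope ring_scope.

(** * A parabolic comparison principle *)

Lemma is_derive_eps (R : realType) (f : R -> R) (x d e : R) : 0 < e ->
  is_derive x (1:R) f d ->
  exists2 r : R, 0 < r & forall h : R, `|h| < r -> `|f (x + h) - f x - d * h| <= e * `|h|.
Proof.
move=> e0 fd.
have /cvgrPdist_le /(_ e e0) := @ex_derive _ _ _ _ _ _ _ fd.
rewrite -/('D_1 f x) (@derive_val _ _ _ _ _ _ _ fd).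
rewrite near_withinE => /nbhs_ballP[r /= r0 H]; exists r => // h hr.
have [->|h0] := eqVneq h 0; first by rewrite addr0 mulr0 subrr subr0 normr0 mulr0.
have := H h; rewrite /ball/= sub0r normrN => /(_ hr h0).
rewrite /GRing.scale/= mulr1 [h + x]addrC => K.
rewrite -[X in `|X - _|](mulVKf h0) -opprB normrN mulrC -mulrBr normrM mulrC ler_wpM2r//.
Qed.

Lemma is_derive_continuous (R : realType) (f : R -> R) (x d : R) :
  is_derive x (1:R) f d -> {for x, continuous f}.
Proof.
move=> fd; apply: differentiable_continuous; apply/derivable1_diffP.
exact: (@ex_derive _ _ _ _ _ _ _ fd).
Qed.

(** If d2 were positive, df would be positive just to the right of its zero x, and
    f would increase beyond its maximum. *)
Lemma max_second_derivative (R : realType) (f df : R -> R) (x d2 : R) :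
  (forall y, is_derive y (1:R) f (df y)) -> is_derive x (1:R) df d2 ->
  (forall y, f y <= f x) -> df x = 0 /\ d2 <= 0.
Proof.
move=> fdf dfd2 fmax.
have dx0 : df x = 0.
  have xI : x \in `]x - 1, x + 1[ by rewrite in_itv/=; apply/andP; split; lra.
  have := @derive1_at_max _ f (x - 1) (x + 1) x ltac:(lra) (fun t _ => @ex_derive _ _ _ _ _ _ _ (fdf t)) xI (fun t _ => fmax t).
  by move=> /@derive_val <-; rewrite (@derive_val _ _ _ _ _ _ _ (fdf x)).
split => //; rewrite leNgt; apply/negP => d2gt0.
have [r r0 H] := is_derive_eps (divr_gt0 d2gt0 (ltr0n _ 2)) dfd2.
have xr : x < x + r / 2 by lra.
have [c /=] := @MVT _ f df _ _ xr (fun y _ => fdf y) (derivable_within_continuous (fun y _ => @ex_derive _ _ _ _ _ _ _ (fdf y))).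
rewrite in_itv/= => /andP[xc cr] /eqP; apply/negP.
have := H (c - x); rewrite [x + (c - x)]addrC subrK dx0 subr0 gtr0_norm ?subr_gt0//.
move=> /(_ ltac:(lra)) /ler_normlP[dc _].
have : 0 < df c by nra.
have := fmax (x + r / 2); nra.
Qed.

Lemma left_max_derivative_ge0 (R : realType) (f : R -> R) (s x d : R) :
  s < x -> is_derive x (1:R) f d ->
  (forall y, s <= y <= x -> f y <= f x) -> 0 <= d.
Proof.
move=> sx fd fmax; rewrite leNgt; apply/negP => d0.
have d20 : 0 < - d / 2 by lra.
have [r r0 H] := is_derive_eps d20 fd.
pose h := Num.min (r / 2) (x - s).
have h0 : 0 < h by rewrite lt_min; apply/andP; split; lra.
have hr : h < r by rewrite gt_min; apply/orP; left; lra.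
have hs : h <= x - s by rewrite ge_min; apply/orP; right; lra.
have := H (- h); rewrite normrN gtr0_norm// => /(_ hr) /ler_normlP[].
have := fmax (x - h) ltac:(apply/andP; split; lra). nra.
Qed.

(** The barrier b = e exp((3 + M)(t - s)) (1 + x^2) satisfies
    b_t + a b_x - b_xx > 0 as soon as |a| <= M, because 2 |x| <= 1 + x^2.  The
    linear growth of D confines the points where D > b to a compact
    set; at a positive maximum of D - b the derivative conditions contradict
    the equation. *)
Lemma parabolic_comparison (R : realType) (D a Dt Dx Dxx : R -> R -> R)
    (s T M C e : R) :
  s <= T -> 0 < e -> 0 <= M -> 0 <= C ->
  (forall t x, s <= t <= T ->
     {for (t, x), continuous (fun q : R * R => D q.1 q.2)}) ->
  (forall t x, s < t <= T -> is_derive t (1:R) (D ^~ x) (Dt t x)) ->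
  (forall t x, s < t <= T -> is_derive x (1:R) (D t) (Dx t x)) ->
  (forall t x, s < t <= T -> is_derive x (1:R) (Dx t) (Dxx t x)) ->
  (forall t x, s < t <= T -> Dt t x + a t x * Dx t x = Dxx t x) ->
  (forall t x, s < t <= T -> `|a t x| <= M) ->
  (forall t x, s <= t <= T -> D t x <= C * (1 + `|x|)) ->
  (forall x, D s x <= e * (1 + x ^+ 2)) ->
  forall t x, s <= t <= T ->
    D t x <= e * expR ((3 + M) * (t - s)) * (1 + x ^+ 2).
Proof.
move=> sT e0 M0 C0 cD dt dx dxx eqD aM growth init t0 x0 /andP[st0 t0T].
pose B t := e * expR ((3 + M) * (t - s)).
have eB t : s <= t -> e <= B t.
  move=> st; rewrite /B ler_peMr ?(ltW e0)// -[leLHS]expR0 ler_expR.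
  by rewrite mulr_ge0 ?subr_ge0//; lra.
pose Z t x := D t x - B t * (1 + x ^+ 2).
rewrite -/(B t0) -subr_le0 -/(Z t0 x0) leNgt; apply/negP => Z0.
(* Beyond |x| = 2 C / e the barrier dominates the growth bound; L is moreover
   at least 1 and large enough for [- L, L] to contain x0. *)
pose L := 1 + 2 * C / e + `|x0|.
have Ce0 : 0 <= 2 * C / e by rewrite divr_ge0 ?(ltW e0)//; lra.
have L1 : 1 <= L by rewrite /L; have := normr_ge0 x0; lra.
have ZL t x : s <= t <= T -> L <= `|x| -> Z t x <= 0.
  move=> st Lx; have /andP[st1 _] := st; rewrite subr_le0.
  apply: (le_trans (growth _ _ st)).
  have eL : 2 * C <= e * L.
    have : e * (2 * C / e) = 2 * C by field; rewrite gt_eqF.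
    by rewrite /L; have := normr_ge0 x0; nra.
  have := eB _ st1; rewrite -(real_normK (num_real x)).
  have x1 := le_trans L1 Lx.
  move: (B t) => b eb.
  move: Lx x1; move: (`|x|) => n Ln n1.
  have h1 : 0 <= e * n * (n - L) by rewrite !mulr_ge0 ?subr_ge0//; lra.
  have h2 : 0 <= (b - e) * (1 + n * n) by apply: mulr_ge0; nra.
  have h3 : 0 <= n * (e * L - 2 * C) by apply: mulr_ge0; lra.
  have h4 : 0 <= C * (n - 1) by apply: mulr_ge0; lra.
  nra.
pose K := `[s, T] `*` `[- L, L] : set (R * R).
have Kc : compact K by apply: compact_setX; exact: segment_compact.
have x0L : `|x0| <= L by rewrite /L; lra.
have K0 : K !=set0.
  by exists (t0, x0); split => /=; rewrite in_itv/= ?st0// -ler_norml.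
have Zc : {within K, continuous (fun q : R * R => Z q.1 q.2)}.
  apply: continuous_in_subspaceT => -[t x] /set_mem [/=]; rewrite !in_itv/= => tI _.
  have cB : {for (t, x), continuous (fun q : R * R => B q.1 * (1 + q.2 ^+ 2))}.
    apply: continuousM => /=.
      apply: continuousM; first exact: cst_continuous.
      apply: (@continuous_comp _ _ _ (fun q : R * R => (3 + M) * (q.1 - s)) expR); last exact: continuous_expR.
      apply: continuousM; first exact: cst_continuous.
      apply: continuousB; last exact: cst_continuous.
      exact: cvg_fst.
    apply: continuousD; first exact: cst_continuous.
    apply: (@continuous_comp _ _ _ snd (fun y : R => y ^+ 2)); last exact: exprn_continuous.
    exact: cvg_snd.
  exact: continuousB (cD _ _ tI) cB.
have [[t1 x1] /set_mem [/=]] := compact_EVT_max K0 Kc Zc.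
rewrite !in_itv/= => tI x1L maxZ.
have Zpos : 0 < Z t1 x1.
  apply: lt_le_trans Z0 _; apply: (maxZ (t0, x0)); apply/mem_set.
  by split => /=; rewrite in_itv/= ?st0// -ler_norml.
have {}maxZ t x : s <= t <= T -> Z t x <= Z t1 x1.
  move=> st; have [Lx|/ltW xL] := lerP L `|x|.
    by apply: le_trans (ltW Zpos); exact: ZL.
  by apply: (maxZ (t, x)); apply/mem_set; split => //=; rewrite in_itv/= -ler_norml.
have st1 : s < t1.
  rewrite lt_neqAle (andP tI).1 andbT; apply/eqP => st1; move: Zpos.
  rewrite -st1 /Z /B subrr mulr0 expR0 mulr1.
  by have := init x1; lra.
have tI' : s < t1 <= T by rewrite st1 (andP tI).2.
have dB t : is_derive t (1:R) B ((3 + M) * B t).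
  rewrite /B; apply: is_derive_eq.
  by rewrite /GRing.scale/=; ring.
have dZt : is_derive t1 (1:R) (Z ^~ x1) (Dt t1 x1 - (3 + M) * B t1 * (1 + x1 ^+ 2)).
  have h1 := dt _ x1 tI'.
  rewrite /Z; apply: is_derive_eq.
  by rewrite /GRing.scale/=; ring.
have dZx x : is_derive x (1:R) (Z t1) (Dx t1 x - B t1 * (2 * x)).
  have h1 := dx _ x tI'.
  rewrite /Z; apply: is_derive_eq.
  by rewrite /GRing.scale/=; ring.
have dZxx : is_derive x1 (1:R) (fun x => Dx t1 x - B t1 * (2 * x)) (Dxx t1 x1 - B t1 * 2).
  have h1 := dxx _ x1 tI'.
  apply: is_derive_eq.
  by rewrite /GRing.scale/=; ring.
have [Zx0 Zxx0] := max_second_derivative dZx dZxx (fun y => maxZ t1 y tI).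
have Zt0 := left_max_derivative_ge0 st1 dZt.
have {}Zt0 := Zt0 (fun y h => maxZ y x1 ltac:(case/andP: h => h1 h2; rewrite h1 (le_trans h2)//; case/andP: tI => //)).
have eqt := eqD _ x1 tI'; have at1 := aM _ x1 tI'.
have Bpos : 0 < B t1 by apply: lt_le_trans (eB _ (ltW st1)).
have aDx : `|a t1 x1 * Dx t1 x1| <= M * (B t1 * (2 * `|x1|)).
  have -> : Dx t1 x1 = B t1 * (2 * x1) by lra.
  have aux (p q y : R) : `|p| <= M -> 0 < q ->
      `|p * (q * (2 * y))| <= M * (q * (2 * `|y|)).
    move=> pM q0; rewrite !normrM (gtr0_norm q0) (ger0_norm (ler0n R 2)).
    by rewrite ler_wpM2r// !mulr_ge0// ltW.
  exact: aux.
have {aDx}/ler_normlP[aDx _] := aDx.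
have x2 : 2 * `|x1| <= 1 + x1 ^+ 2.
  have := sqr_ge0 (1 - `|x1|); rewrite -(real_normK (num_real x1)); nra.
have h1 : M * (B t1 * (2 * `|x1|)) <= M * B t1 * (1 + x1 ^+ 2).
  by rewrite -mulrA ler_wpM2l// ler_wpM2l// ltW.
have := sqr_ge0 x1. nra.
Qed.

(** * Uniform boundedness of functionals on L^1 *)

Section gliding_hump.
Context d (T : measurableType d) (R : realType) (mu : {measure set T -> \bar R}).
Variables (f g : nat -> T -> R) (S : nat -> R).
Hypothesis mf : forall n, measurable_fun [set: T] (f n).
Hypothesis S0 : forall n, 0 <= S n.
Hypothesis fS : forall n x, `|f n x| <= S n.
Hypothesis ig : forall n, mu.-integrable [set: T] (EFin \o g n).
Hypothesis g1 : forall n, \int[mu]_x `|g n x| <= 1.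
Hypothesis fg : forall n, 2 / 3 * S n <= `| \int[mu]_x (f n x * g n x) |.

Let c (n : nat) : R := 3^-1 ^+ n.

(** Partial sums of the series of 3^-k (+/- g_k), the k-th sign being chosen so
    that the new term does not cancel the previous ones against f_k. *)
Fixpoint hump_sum (n : nat) : T -> R :=
  if n is k.+1 then
    let plus := fun x => hump_sum k x + c k * g k x in
    let minus := fun x => hump_sum k x - c k * g k x in
    if `| \int[mu]_x (f k x * plus x) | < `| \int[mu]_x (f k x * minus x) |
    then minus else plus
  else fun=> 0.

Let c_gt0 n : 0 < c n. Proof. by rewrite exprn_gt0. Qed.

Lemma hump_sumS n x : hump_sum n.+1 x = hump_sum n x + c n * g n x \/
  hump_sum n.+1 x = hump_sum n x - c n * g n x.
Proof. by move=> /=; case: ifP => _; [right|left]. Qed.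

Let icg n : mu.-integrable [set: T] (EFin \o (fun x => c n * g n x)).
Proof. exact: (integrableZl measurableT (c n) (ig n)). Qed.

Lemma integrable_hump_sum n : mu.-integrable [set: T] (EFin \o hump_sum n).
Proof.
elim: n => [|n ih]; first exact: integrable0.
rewrite /=; case: ifP => _.
  exact: (integrableB measurableT ih (icg n)).
exact: (integrableD measurableT ih (icg n)).
Qed.

Lemma integrable_bounded_mul n (h : T -> R) : mu.-integrable [set: T] (EFin \o h) ->
  mu.-integrable [set: T] (EFin \o (fun x => f n x * h x)).
Proof.
move=> ih; have := integrableMr measurableT (mf n) _ ih; apply.
exists (S n); split; first exact: num_real.
by move=> M SM x _ /=; exact: le_trans (fS n x) (ltW SM).
Qed.

(** One of |P + Q| and |P - Q| is at least |Q|. *)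
Lemma hump_sum_large n :
  c n * (2 / 3 * S n) <= `| \int[mu]_x (f n x * hump_sum n.+1 x) |.
Proof.
set P := \int[mu]_x (f n x * hump_sum n x).
set Q := \int[mu]_x (f n x * (c n * g n x)).
have iP := integrable_bounded_mul n (integrable_hump_sum n).
have iQ := integrable_bounded_mul n (icg n).
have QE : `|Q| = c n * `| \int[mu]_x (f n x * g n x) |.
  rewrite -[X in X * _](gtr0_norm (c_gt0 n)) -normrM -RintegralZl//.
    by congr (`|_|); apply: eq_Rintegral => x _; rewrite mulrCA.
  exact: integrable_bounded_mul.
have plusE : \int[mu]_x (f n x * (hump_sum n x + c n * g n x)) = P + Q.
  by rewrite -RintegralD//; apply: eq_Rintegral => x _; rewrite mulrDr.
have minusE : \int[mu]_x (f n x * (hump_sum n x - c n * g n x)) = P - Q.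
  by rewrite -RintegralB//; apply: eq_Rintegral => x _; rewrite mulrBr.
have QS : c n * (2 / 3 * S n) <= `|Q| by rewrite QE ler_pM2l.
have PQ : 2 * `|Q| <= `|P + Q| + `|P - Q|.
  have -> : 2 * `|Q| = `|(P + Q) - (P - Q)|.
    rewrite -[X in X * _](ger0_norm (ler0n R 2)) -normrM; congr (Num.norm _); ring.
  exact: ler_normB.
rewrite /=; case: ifPn; rewrite plusE minusE; first by lra.
by rewrite -leNgt; lra.
Qed.

Let H (x : T) : \bar R := (\sum_(k <oo) (c k * `|g k x|)%:E)%E.

Let sum_c n : \sum_(0 <= k < n) c k <= 3 / 2.
Proof.
suff -> : \sum_(0 <= k < n) c k = 3 / 2 - 3 / 2 * c n by have := c_gt0 n; lra.
elim: n => [|n ih]; first by rewrite big_nil /c expr0 mulr1 subrr.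
by rewrite big_nat_recr//= ih /c exprS; field.
Qed.

Let mcg n : measurable_fun [set: T] (fun x => c n * `|g n x|).
Proof.
apply: measurable_funM => //.
apply: measurableT_comp => //.
by have /integrableP[/measurable_EFinP] := ig n.
Qed.

Let iH : mu.-integrable [set: T] H.
Proof.
have H0 k x : [set: T] x -> (0 <= (c k * `|g k x|)%:E)%E.
  by move=> _; rewrite lee_fin mulr_ge0// ltW.
apply/integrableP; split.
  apply: ge0_emeasurable_sum => [k x Dx _|k _]; first exact: H0.
  exact/measurable_EFinP.
under eq_integral.
  move=> x _; rewrite gee0_abs; last by apply: nneseries_ge0 => k _ _; exact: H0.
  over.
rewrite integral_nneseries//; last by move=> n; exact/measurable_EFinP.
apply: (@le_lt_trans _ _ (3 / 2)%:E); last by rewrite ltry.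
apply: lime_le.
  by apply: is_cvg_nneseries => k _ _; apply: integral_ge0 => x _; exact: H0.
apply: nearW => n; apply: (@le_trans _ _ (\sum_(0 <= k < n) (c k)%:E)%E).
  apply: lee_sum => k _; under eq_integral do rewrite EFinM.
  have := ig k => /integrable_norm igk.
  rewrite integralZl// -[leRHS]mule1 lee_pmul2l ?lte_fin//.
  have -> : (\int[mu]_x `|g k x|%:E = (\int[mu]_x `|g k x|)%:E)%E.
    by rewrite /Rintegral fineK//; exact: integrable_fin_num igk.
  by rewrite lee_fin.
by rewrite sumEFin lee_fin.
Qed.

Let incr n x : `|hump_sum n.+1 x - hump_sum n x| = c n * `|g n x|.
Proof.
have -> : c n * `|g n x| = `|c n * g n x| by rewrite normrM gtr0_norm.
have [->|->] := hump_sumS n x; first by rewrite addrC addKr.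
by rewrite addrC addKr normrN.
Qed.

Let dominated n x : (`|(hump_sum n x)%:E| <= H x)%E.
Proof.
apply: (@le_trans _ _ (\sum_(0 <= k < n) (c k * `|g k x|)%:E)%E).
  rewrite sumEFin lee_fin; elim: n => [|n ih]; first by rewrite big_nil/= normr0.
  rewrite big_nat_recr//= -incr; rewrite -/(hump_sum n.+1).
  rewrite -[X in `|X| <= _](subrK (hump_sum n x)) addrC.
  by apply: le_trans (ler_normD _ _) _; rewrite lerD2l.
by apply: nneseries_lim_ge => k _ _; rewrite lee_fin mulr_ge0// ltW.
Qed.

Let h (x : T) : R := fine (limn_esup (fun n => (hump_sum n x)%:E)).

Let mh : measurable_fun [set: T] h.
Proof.
apply: measurableT_comp; first exact: fine_measurable.
apply: measurable_realfun.measurable_fun_limn_esup => n.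
by have /integrableP[] := integrable_hump_sum n.
Qed.

Let ae_cvg : {ae mu, forall x, [set: T] x ->
  (hump_sum n x)%:E @[n --> \oo] --> (h x)%:E}.
Proof.
have := integrable_ae measurableT iH; apply: filterS => x Hx _.
have {}Hx := Hx I.
have cs : cvgn (hump_sum ^~ x).
  have -> : hump_sum ^~ x = series (fun n => hump_sum n.+1 x - hump_sum n x).
    apply/funext => n; rewrite /series/= telescope_sumr//=.
    by rewrite subr0.
  apply: normed_cvg.
  have -> : [normed series (fun n => hump_sum n.+1 x - hump_sum n x)] =
      series (fun k => c k * `|g k x|).
    by apply/funext => n; rewrite /series/=; apply: eq_bigr => k _; rewrite incr.
  apply: nondecreasing_is_cvgn.
    apply/nondecreasing_seqP => n; rewrite /series/= big_nat_recr//= lerDl.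
    by rewrite mulr_ge0// ltW.
  exists (fine (H x)) => _ [n _ <-]; rewrite -lee_fin fineK// -sumEFin.
  by apply: nneseries_lim_ge => k _ _; rewrite lee_fin mulr_ge0// ltW.
have ce : (hump_sum n x)%:E @[n --> \oo] --> (limn (hump_sum ^~ x))%:E.
  by apply: cvg_EFin => //; exact: nearW.
rewrite /h is_cvg_limn_esupE; last by apply/cvg_ex; exists (limn (hump_sum ^~ x))%:E.
by rewrite (cvg_lim _ ce).
Qed.

Let N (u : T -> R) := \int[mu]_x `|u x|.

Let ih : mu.-integrable [set: T] (EFin \o h).
Proof.
have [] := @dominated_convergence _ _ _ mu _ measurableT
  (fun n x => (hump_sum n x)%:E) (EFin \o h) H => //.
- by move=> n; have /integrableP[] := integrable_hump_sum n.
- exact/measurable_EFinP.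
- by apply: aeW => x n _; exact: dominated.
Qed.

Let N_cvg : N (fun x => hump_sum n x - h x) @[n --> \oo] --> 0.
Proof.
have [] := @dominated_convergence _ _ _ mu _ measurableT
  (fun n x => (hump_sum n x)%:E) (EFin \o h) H => //.
- by move=> n; have /integrableP[] := integrable_hump_sum n.
- exact/measurable_EFinP.
- by apply: aeW => x n _; exact: dominated.
move=> _ + _ => /fine_cvgP[_]; apply: cvg_trans.
by apply: near_eq_cvg; apply: nearW => n.
Qed.

(** The L^1 distance covered after step n is at most the geometric tail
    of 3^-k over k > n, namely 3^-n / 2. *)
Let N_hump n j : N (fun x => hump_sum (n.+1 + j) x - hump_sum n.+1 x) <= (c n - c (n + j)) / 2.
Proof.
elim: j => [|j IH].
  rewrite !addn0 subrr mul0r /N.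
  by rewrite (@eq_Rintegral _ _ _ mu setT (cst 0)) ?Rintegral_cst ?mul0r// => x _; rewrite subrr normr0.
have iD k l : mu.-integrable [set: T] (EFin \o (fun x => hump_sum k x - hump_sum l x)).
  exact: (integrableB measurableT (integrable_hump_sum k) (integrable_hump_sum l)).
have iN k l : mu.-integrable [set: T] (EFin \o (fun x => `|hump_sum k x - hump_sum l x|)).
  exact: integrable_norm (iD k l).
apply: (@le_trans _ _ (N (fun x => hump_sum (n.+1 + j) x - hump_sum n.+1 x) +
   N (fun x => hump_sum (n.+1 + j.+1) x - hump_sum (n.+1 + j) x))).
  rewrite /N -RintegralD//; apply: le_Rintegral => //.
    exact: (integrableD measurableT (iN _ _) (iN _ _)).
  move=> x _; rewrite [leRHS]addrC; apply: le_trans (ler_normD _ _).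
  by rewrite addrA subrK.
have -> : (c n - c (n + j.+1)) / 2 = (c n - c (n + j)) / 2 + c (n.+1 + j).
  by rewrite addSn addnS /c exprS; field.
apply: lerD => //; rewrite /N addnS.
rewrite (@eq_Rintegral _ _ _ mu setT (fun x => c (n.+1 + j) * `|g (n.+1 + j) x|)); last first.
  by move=> x _; exact: incr.
rewrite RintegralZl//; last exact: integrable_norm (ig _).
by rewrite -[leRHS]mulr1 ler_pM2l.
Qed.

(** For the limit h of the partial sums, the terms up to n contribute at least
    3^-n (2/3) S_n to the pairing with f_n, and the remaining ones at most
    S_n 3^-n / 2; the difference is 3^-n S_n / 6. *)
Lemma gliding_hump : exists2 h : T -> R, mu.-integrable [set: T] (EFin \o h) &
  forall n, 3^-1 ^+ n * S n / 6 <= `| \int[mu]_x (f n x * h x) |.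
Proof.
exists h => // n.
have Nh : N (fun x => hump_sum n.+1 x - h x) <= c n / 2.
  have : (fun j => c n / 2 + N (fun x => hump_sum (n.+1 + j) x - h x)) @ \oo --> c n / 2 + 0.
    apply: cvgD; first exact: cvg_cst.
    by have := N_cvg; rewrite -(cvg_shiftn n.+1); under eq_fun do rewrite addnC.
  rewrite addr0 => lim_c; rewrite -(cvg_lim (@Rhausdorff R) lim_c).
  apply: limr_ge; first exact: cvgP lim_c.
  apply: nearW => j.
  apply: (@le_trans _ _ (N (fun x => hump_sum (n.+1 + j) x - hump_sum n.+1 x) +
      N (fun x => hump_sum (n.+1 + j) x - h x))); last first.
    by rewrite lerD2r; apply: le_trans (N_hump n j) _; have := c_gt0 (n + j); lra.
  have iB k : mu.-integrable [set: T] (EFin \o (fun x => `|hump_sum k x - h x|)).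
    exact: integrable_norm (integrableB measurableT (integrable_hump_sum k) ih).
  have iN : mu.-integrable [set: T]
      (EFin \o (fun x => `|hump_sum (n.+1 + j) x - hump_sum n.+1 x|)).
    apply: integrable_norm.
    exact: (integrableB measurableT (integrable_hump_sum _) (integrable_hump_sum _)).
  rewrite /N -RintegralD//; apply: le_Rintegral => //.
    exact: (integrableD measurableT iN (iB _)).
  move=> x _; rewrite distrC [`|hump_sum (_ + j) _ - h x|]distrC.
  rewrite [leRHS]addrC; apply: le_trans (ler_normD _ _).
  by rewrite addrA subrK.
have iD : mu.-integrable [set: T] (EFin \o (fun x => hump_sum n.+1 x - h x)).
  exact: (integrableB measurableT (integrable_hump_sum _) ih).
have diff : `| \int[mu]_x (f n x * (hump_sum n.+1 x - h x)) | <= S n * (c n / 2).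
  apply: le_trans (le_normr_Rintegral _ (integrable_bounded_mul n iD)) _ => //.
  apply: (@le_trans _ _ (\int[mu]_x (S n * `|hump_sum n.+1 x - h x|))).
    apply: le_Rintegral => //.
    - exact: integrable_norm (integrable_bounded_mul n iD).
    - exact: (integrableZl measurableT (S n) (integrable_norm iD)).
    - by move=> x _; rewrite normrM ler_wpM2r.
  rewrite RintegralZl//; last exact: integrable_norm iD.
  by rewrite ler_wpM2l.
have large := hump_sum_large n.
have E : \int[mu]_x (f n x * (hump_sum n.+1 x - h x)) =
    \int[mu]_x (f n x * hump_sum n.+1 x) - \int[mu]_x (f n x * h x).
  rewrite -RintegralB//; first by apply: eq_Rintegral => x _; rewrite mulrBr.
    exact: integrable_bounded_mul (integrable_hump_sum _).
  exact: integrable_bounded_mul.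
rewrite E in diff.
have := lerB_dist (\int[mu]_x (f n x * hump_sum n.+1 x)) (\int[mu]_x (f n x * h x)).
rewrite -/(c n); lra.
Qed.
End gliding_hump.

(** The test function is the normalized indicator of a small interval around
    x0. *)
Lemma average_near_sup (R : realType) (f : R -> R) (S x0 : R) :
  continuous f -> 3 / 4 * S < `|f x0| -> 0 < S ->
  exists2 g : R -> R, (@lebesgue_measure R).-integrable [set: R] (EFin \o g) &
    \int[lebesgue_measure]_x `|g x| <= 1 /\
    2 / 3 * S <= `| \int[lebesgue_measure]_x (f x * g x) |.
Proof.
move=> cf fx0 S0; pose mu := @lebesgue_measure R.
have [e e0 He] : exists2 e : R, 0 < e & forall y, `[x0 - e, x0 + e]%classic y ->
    `|f x0 - f y| <= S / 12.
  have /cvgrPdist_le /(_ (S / 12)) := cf x0; rewrite divr_gt0// => /(_ isT).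
  move=> /nbhs_ballP[r /= r0 H]; exists (r / 2); first by rewrite divr_gt0.
  move=> y; rewrite /= in_itv/= => yI; apply: H.
  by rewrite /ball/= distrC; apply/ltr_normlP; split; case/andP: yI; lra.
set A := `[x0 - e, x0 + e]%classic in He.
have mA : measurable A by exact: measurable_itv.
have muA : fine (mu A) = 2 * e.
  by rewrite /mu lebesgue_measure_itv/= lte_fin ifT/=; [ring|lra].
have e2 : 0 < (2 * e)^-1 by rewrite invr_gt0; lra.
have iA (h : R -> R) : continuous h -> mu.-integrable A (EFin \o h).
  move=> ch; apply: continuous_compact_integrable; first exact: segment_compact.
  exact: continuous_subspaceT.
have intA (h : R -> R) : continuous h ->
    \int[mu]_x (h x * ((2 * e)^-1 * \1_A x)) = (2 * e)^-1 * \int[mu]_(x in A) h x.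
  move=> ch; rewrite -RintegralZl//; last exact: iA.
  rewrite [RHS]Rintegral_mkcond; apply: eq_Rintegral => x _.
  by rewrite patch_indic/= mulrCA mulrA.
exists (fun x => (2 * e)^-1 * \1_A x).
  have iI : mu.-integrable [set: R] (EFin \o \1_A) by exact: integrable_indic_itv.
  exact: (integrableZl measurableT ((2 * e)^-1) iI).
split.
  rewrite (@eq_Rintegral _ _ _ mu setT (fun x => cst 1 x * ((2 * e)^-1 * \1_A x))); last first.
    by move=> x _; rewrite mul1r ger0_norm// mulr_ge0// ltW.
  rewrite intA; last exact: cst_continuous.
  by rewrite Rintegral_cst// muA mul1r mulVf// gt_eqF//; lra.
rewrite intA// normrM (gtr0_norm e2) [leRHS]mulrC ler_pdivlMr; last by lra.
have lower (h : R -> R) : continuous h -> (forall y, A y -> 2 / 3 * S <= h y) ->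
    2 / 3 * S * (2 * e) <= \int[mu]_(x in A) h x.
  move=> ch hS; rewrite -muA -Rintegral_cst//; apply: le_Rintegral => //.
  - exact: (iA (cst _) (@cst_continuous _ _ _)).
  - exact: iA.
have [f0|f0] := lerP 0 (f x0).
  apply: le_trans (ler_norm _); apply: lower => // y Ay.
  have /ler_normlP[] := He _ Ay; rewrite ger0_norm// in fx0; lra.
rewrite -normrN.
have -> : - (\int[mu]_(x in A) f x) = \int[mu]_(x in A) (- f x).
  rewrite -mulN1r -RintegralZl//; last exact: iA.
  by apply: eq_Rintegral => x _; rewrite mulN1r.
apply: le_trans (ler_norm _); apply: lower.
  by move=> y; apply: continuousN; exact: cf.
move=> y Ay; have /ler_normlP[] := He _ Ay; rewrite ltr0_norm// in fx0; lra.
Qed.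

(** Otherwise there are times t_n -> 0 at which the sup norm exceeds 4^n, and
    the gliding hump applied to f (t_n) gives one integrable h whose pairings with
    f (t_n) grow like (4/3)^n, although they converge. *)
Lemma weak_star_bounded (R : realType) (f : R -> R -> R) (l : (R -> R) -> R) :
  (forall t, 0 < t -> continuous (f t)) ->
  (forall t, 0 < t -> exists M, forall x, `|f t x| <= M) ->
  (forall g, (@lebesgue_measure R).-integrable [set: R] (EFin \o g) ->
    \int[lebesgue_measure]_x (f t x * g x) @[t --> 0^'+] --> l g) ->
  exists2 d : R, 0 < d & exists M, forall t x, 0 < t < d -> `|f t x| <= M.
Proof.
move=> cf bf wf; apply: contrapT => unb.
have {}unb (n : nat) : exists t : R, 0 < t < n.+1%:R^-1 /\
    exists x, 4 ^+ n < `|f t x|.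
  apply: contrapT => H; apply: unb; exists n.+1%:R^-1; first by rewrite invr_gt0.
  exists (4 ^+ n) => t x tn; rewrite leNgt; apply/negP => ftx.
  by apply: H; exists t; split => //; exists x.
have /choice[t tP] := unb.
pose S n := sup [set `|f (t n) x| | x in [set: R]].
have t0 n : 0 < t n by have [/andP[]] := tP n.
have hS n : has_sup [set `|f (t n) x| | x in [set: R]].
  split; first by exists `|f (t n) 0|; exists 0.
  by have [M HM] := bf _ (t0 n); exists M => _ [x _ <-].
have fS n x : `|f (t n) x| <= S n by apply: sup_upper_bound => //; exists x.
have S4 n : 4 ^+ n < S n by have [_ [x]] := tP n; move=> /lt_le_trans; apply.
have S0 n : 0 < S n by apply: lt_trans (S4 n); rewrite exprn_gt0.
have near_sup n : exists x, 3 / 4 * S n < `|f (t n) x|.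
  have S40 : 0 < S n / 4 by rewrite divr_gt0.
  have [_ [x _ <-]] := sup_adherent S40 (hS n).
  by rewrite -/(S n) => h; exists x; lra.
have /choice[g gP] : forall n, exists g : R -> R,
    (@lebesgue_measure R).-integrable [set: R] (EFin \o g) /\
    \int[lebesgue_measure]_x `|g x| <= 1 /\
    2 / 3 * S n <= `| \int[lebesgue_measure]_x (f (t n) x * g x) |.
  move=> n; have [x hx] := near_sup n.
  by have [g h1 h2] := average_near_sup (cf _ (t0 n)) hx (S0 n); exists g.
have [h ih hP] := @gliding_hump _ _ _ (@lebesgue_measure R) (fun n => f (t n)) g S
  (fun n => continuous_measurable_fun (cf _ (t0 n))) (fun n => ltW (S0 n)) fS
  (fun n => (gP n).1) (fun n => (gP n).2.1) (fun n => (gP n).2.2).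
have tcvg : t @ \oo --> (0 : R).
  apply: (squeeze_cvgr _ (cvg_cst (0 : R)) cvg_harmonic).
  by apply: nearW => n; have [/andP[h1 h2] _] := tP n; rewrite /= (ltW h1) ltW.
have /cvg_at_rightP := wf _ ih => /(_ t (conj t0 tcvg)) => cvg_l.
have [M [_ HM]] := cvg_seq_bounded (cvgP _ cvg_l).
have {}HM n : (4 / 3) ^+ n / 6 <= `|M| + 1.
  have := HM (`|M| + 1); rewrite (le_lt_trans (ler_norm _)) ?ltrDl// => /(_ isT n I).
  apply: le_trans; apply: le_trans (hP n); rewrite ler_pM2r//.
  by rewrite expr_div_n mulrC exprVn ler_pM2l ?invr_gt0 ?exprn_gt0// ltW.
have bernoulli n : 1 + n%:R / 3 <= (4 / 3) ^+ n :> R.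
  elim: n => [|n IH]; first by rewrite mul0r addr0 expr0.
  rewrite exprS -natr1; have : (0 : R) <= n%:R by [].
  by move: IH; nra.
near \oo => n.
have : 18 * (`|M| + 1) < n%:R by near: n; exact: nbhs_infty_gtr.
have := bernoulli n; have := HM n; lra.
Unshelve. all: by end_near. Qed.

(** * A priori bounds for solutions *)

(** A continuous function exceeding M somewhere exceeds it on a ball, which has
    positive measure. *)
Lemma continuous_ae_bound (R : realType) (f : R -> R) (M : R) :
  continuous f -> {ae @lebesgue_measure R, forall x, `|f x| <= M} ->
  forall x, `|f x| <= M.
Proof.
move=> cf [N [mN N0 sub]] x; rewrite leNgt; apply/negP => Mfx.
have /cvgrPdist_lt /(_ (`|f x| - M)) := cf x.
rewrite subr_gt0 => /(_ Mfx) /nbhs_ballP[r /= r0 H].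
have : (lebesgue_measure (ball x r) <= lebesgue_measure N)%E.
  apply: le_measure; rewrite ?inE//; first exact: measurable_ball.
  move=> y /H /= fxy; apply: sub => /= fy.
  by have := lerB_dist (f x) (f y); lra.
by rewrite N0 lebesgue_measure_ball ?(ltW r0)// lee_fin leNgt mulrn_wgt0.
Qed.

Lemma Lnorm_oo_leP (R : realType) (f : R -> R) (M : R) :
  ('N[lebesgue_measure]_+oo[EFin \o f] <= M%:E)%E <->
  {ae @lebesgue_measure R, forall x, `|f x| <= M}.
Proof.
have muT : (0 < @lebesgue_measure R [set: R])%E.
  apply: (@lt_le_trans _ _ (lebesgue_measure (ball (0 : R) 1))).
    by rewrite lebesgue_measure_ball.
  by apply: le_measure; rewrite ?inE//; exact: measurable_ball.
rewrite unlock ifT//.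
by split=> [/ess_supP H|H]; [exact: H|apply/ess_supP; exact: H].
Qed.

Lemma continuous_Linfty_bounded (R : realType) (f : R -> R) :
  continuous f -> Linfty f -> exists M, forall x, `|f x| <= M.
Proof.
move=> cf; rewrite /Linfty/= => /andP[_]; rewrite inE /finite_norm /= => fM.
exists (fine 'N[lebesgue_measure]_+oo[EFin \o f]); apply: continuous_ae_bound => //.
apply/Lnorm_oo_leP; rewrite fineK// ge0_fin_numE//; exact: Lnorm_ge0.
Qed.

Lemma bounded_Linfty (R : realType) (f : R -> R) (M : R) :
  continuous f -> (forall x, `|f x| <= M) -> Linfty f.
Proof.
move=> cf fM; rewrite /Linfty/=; apply/andP; split.
  by rewrite inE; exact: continuous_measurable_fun.
rewrite inE /finite_norm/=; apply: (@le_lt_trans _ _ M%:E); last by rewrite ltry.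
by apply/Lnorm_oo_leP; exact: aeW.
Qed.

Section solution_facts.
Context (R : realType) (u0 : R -> R) (u : R -> R -> R).
Hypothesis su : burgers_solution u0 u.

Lemma solution_continuous t : 0 < t -> continuous (u t).
Proof.
by move=> t0 x; apply: differentiable_continuous; exact/derivable1_diffP/(burgers_derivable_x su).
Qed.

(** By compactness of [0, T] a bound near each time suffices: near 0 it comes from
    the weak-* initial condition, near t > 0 from the continuity of the solution
    as a curve in L^oo. *)
Lemma solution_bounded (T : R) :
  exists2 M : R, 0 <= M & forall t x, 0 < t <= T -> `|u t x| <= M.
Proof.
pose P (M t : R) := 0 < t -> forall x, `|u t x| <= M.
have bnd t : 0 < t -> exists M, forall x, `|u t x| <= M.
  move=> t0; apply: continuous_Linfty_bounded; first exact: solution_continuous.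
  exact: (burgers_Linfty su t0).
have cover t : `[0, T]%classic t -> \forall t' \near t & M \near +oo, P M t'.
  rewrite /= in_itv/= => /andP[t0 _].
  suff [r r0 [M HM]] : exists2 r : R, 0 < r & exists M : R, forall t', ball t r t' -> P M t'.
    exists (ball t r, [set M' | M <= M']).
      by split; [exact: nbhsx_ballx|apply: nbhs_pinfty_ge; exact: num_real].
    by move=> [t' M'] /= [/HM h MM'] t'0 x; exact: le_trans (h t'0 x) MM'.
  have [t_eq0|t_neq0] := eqVneq t 0.
    have [d d0 [M HM]] := weak_star_bounded solution_continuous bnd
      (l := fun g => \int[lebesgue_measure]_x (u0 x * g x)) (burgers_initial su).
    exists d => //; exists M => t'; rewrite /ball/= t_eq0 sub0r normrN => t'd t'0 x.
    by apply: HM; rewrite t'0 -(gtr0_norm t'0).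
  have {t_neq0}t0 : 0 < t by rewrite lt_neqAle eq_sym t_neq0.
  have /fine_cvgP[fin /cvgrPdist_lt/(_ 1 ltr01) N1] := burgers_Linfty_continuous su t0.
  have [M HM] := bnd _ t0.
  have [r /= r0 H] := (@nbhs_ballP R R t _).1 (filterI fin N1).
  exists r => //; exists (1 + M) => t' /H[/= fint' Nt'] t'0 x.
  rewrite -(subrK (u t x) (u t' x)); apply: le_trans (ler_normD _ _) _.
  apply: lerD => //.
  have cd : continuous (fun x => u t' x - u t x).
    by move=> y; apply: continuousB; exact: solution_continuous.
  apply: (@continuous_ae_bound _ (fun x => u t' x - u t x)) => //.
  apply/Lnorm_oo_leP; rewrite -(fineK fint') lee_fin; apply: ltW.
  by move: Nt'; rewrite sub0r normrN; apply: le_lt_trans; exact: ler_norm.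
have /compact_near_coveringP := @segment_compact R 0 T.
move=> /(_ R +oo P _ cover) H; near (pinfty_nbhs R) => M.
exists M => [|t x /andP[t0 tT]].
  by near: M; apply: nbhs_pinfty_ge; exact: num_real.
have := (near H M); apply => //.
by rewrite /= in_itv/= tT ltW.
Unshelve. all: by end_near. Qed.
End solution_facts.

(** * Primitives *)

Definition primitive (R : realType) (f : R -> R) (x : R) : R :=
  if 0 <= x then \int[lebesgue_measure]_(y in `[0, x]) f y
  else - (\int[lebesgue_measure]_(y in `[x, 0]) f y).

Lemma continuous_integrable_segment (R : realType) (f : R -> R) (a b : R) :
  continuous f -> (@lebesgue_measure R).-integrable `[a, b] (EFin \o f).
Proof.
move=> cf; apply: continuous_compact_integrable; first exact: segment_compact.
exact: continuous_subspaceT.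
Qed.

Lemma Rintegral_segmentB (R : realType) (f : R -> R) (a b c : R) :
  continuous f -> a <= b -> b <= c ->
  \int[lebesgue_measure]_(y in `[a, c]) f y - \int[lebesgue_measure]_(y in `[a, b]) f y =
  \int[lebesgue_measure]_(y in `[b, c]) f y.
Proof.
move=> cf ab bc; rewrite Rintegral_itvB ?bnd_simp//; last exact: continuous_integrable_segment.
rewrite Rintegral_itv_obnd_cbnd//.
apply: integrableS (continuous_integrable_segment b c cf) => //.
exact: subset_itv_oc_cc.
Qed.

Lemma primitiveE (R : realType) (f : R -> R) (a x : R) : continuous f ->
  a <= 0 -> a <= x -> primitive f x =
  \int[lebesgue_measure]_(y in `[a, x]) f y - \int[lebesgue_measure]_(y in `[a, 0]) f y.
Proof.
move=> cf a0 ax; rewrite /primitive; have [x0|x0] := lerP 0 x.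
  by rewrite Rintegral_segmentB.
by rewrite -(@Rintegral_segmentB _ _ a x 0)// ?opprB// ltW.
Qed.

Lemma is_derive_primitive (R : realType) (f : R -> R) (x : R) :
  continuous f -> is_derive x (1 : R) (primitive f) (f x).
Proof.
move=> cf; pose a : R := - `|x| - 1.
have a0 : a <= 0 by rewrite /a; have := normr_ge0 x; lra.
have ax : a < x by rewrite /a; have /ler_normlP[] := lexx `|x|; lra.
pose c := \int[lebesgue_measure]_(y in `[a, 0]) f y.
pose F y := \int[lebesgue_measure]_(z in `[a, y]) f z.
have [dF F'] := @continuous_FTC1_closed _ f a x (x + 1) ltac:(lra)
  (continuous_integrable_segment a (x + 1) cf) ax (cf x).
have dFc : is_derive x (1 : R) (fun y => F y - c) (f x).
  have dF' : is_derive x (1 : R) F (f x).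
    by apply: DeriveDef; [exact: dF|rewrite -derive1E; exact: F'].
  by apply: is_derive_eq; rewrite subr0.
apply: near_eq_is_derive dFc.
near=> y; rewrite (@primitiveE _ f a)//.
by apply: ltW; near: y; exact: lt_nbhsr.
Unshelve. all: by end_near. Qed.

Lemma primitive0 (R : realType) (f : R -> R) : primitive f 0 = 0.
Proof. by rewrite /primitive lexx set_itv1 Rintegral_set1. Qed.

Lemma primitive_diff (R : realType) (f G : R -> R) (x : R) : continuous f ->
  (forall y, is_derive y (1 : R) G (f y)) -> primitive f x = G x - G 0.
Proof.
move=> cf dG; have dH y : is_derive y (1 : R) (fun z => primitive f z - G z) 0.
  have := is_derive_primitive y cf => ?; have := dG y => ?.
  by apply: is_derive_eq; rewrite subrr.
by have := is_derive_0_is_cst x 0 dH; rewrite primitive0 sub0r; lra.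
Qed.

Lemma primitive_lipschitz (R : realType) (f : R -> R) (M : R) : continuous f ->
  (forall y, `|f y| <= M) ->
  forall x y, `|primitive f x - primitive f y| <= M * `|x - y|.
Proof.
move=> cf fM x y; wlog xy : x y / y <= x.
  move=> H; have [|/ltW] := leP y x; first exact: H.
  by rewrite distrC [`|x - y|]distrC; exact: H.
pose a := Num.min 0 y.
have a0 : a <= 0 by rewrite ge_min lexx.
have ay : a <= y by rewrite ge_min lexx orbT.
rewrite (primitiveE cf a0 (le_trans ay xy)) (primitiveE cf a0 ay).
rewrite opprB addrA subrK Rintegral_segmentB//.
have If := continuous_integrable_segment y x cf.
apply: le_trans (le_normr_Rintegral _ If) _ => //.
have -> : M * `|x - y| = \int[lebesgue_measure]_(z in `[y, x]) M.
  rewrite Rintegral_cst; last exact: measurable_itv.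
  have -> : fine ((@lebesgue_measure R) `[y, x]) = x - y.
    rewrite lebesgue_measure_itv/= lte_fin.
    by move: xy; rewrite le_eqVlt => /orP[/eqP ->|->//]; rewrite ltxx subrr.
  by rewrite ger0_norm ?subr_ge0.
apply: le_Rintegral => //; first exact: integrable_norm.
exact: (@continuous_integrable_segment _ (cst M) y x (@cst_continuous _ _ _)).
Qed.

(** The pairing function, a signed indicator, is integrable, so that the primitive
    can be evaluated along weak-* convergence. *)
Lemma primitive_pairing (R : realType) (x : R) : exists2 g : R -> R,
  (@lebesgue_measure R).-integrable [set: R] (EFin \o g) &
  forall f, continuous f -> primitive f x = \int[lebesgue_measure]_y (f y * g y).
Proof.
have seg (a b : R) f : \int[lebesgue_measure]_(y in `[a, b]) f y =
    \int[lebesgue_measure]_y (f y * \1_`[a, b] y).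
  by rewrite [LHS]Rintegral_mkcond; apply: eq_Rintegral => y _; rewrite patch_indic.
have [x0|x0] := leP 0 x.
  exists \1_`[0, x]; first exact: integrable_indic_itv.
  by move=> f cf; rewrite /primitive x0 seg.
have iI : (@lebesgue_measure R).-integrable [set: R] (EFin \o \1_`[x, 0]).
  exact: integrable_indic_itv.
exists (fun y => -1 * \1_`[x, 0] y); first exact: (integrableZl measurableT (-1) iI).
move=> f cf; rewrite /primitive leNgt x0/= -[LHS]mulN1r -RintegralZl//; last first.
  exact: continuous_integrable_segment.
by rewrite seg; apply: eq_Rintegral => y _; rewrite mulrA [f y * _]mulrC -!mulrA.
Qed.

Lemma is_derive_segment_integral (R : realType) (d dt : R -> R -> R) (a b t : R) :
  0 < t -> (forall s : R, 0 < s -> continuous (d s)) ->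
  (forall s x : R, 0 < s -> is_derive s (1 : R) (d ^~ x) (dt s x)) ->
  (forall s x : R, 0 < s -> {for (s, x), continuous (fun q : R * R => dt q.1 q.2)}) ->
  is_derive t (1 : R) (fun s => \int[lebesgue_measure]_(x in `[a, b]) d s x)
    (\int[lebesgue_measure]_(x in `[a, b]) dt t x).
Proof.
move=> t0 cd ddt cdt; have [ba|ab] := ltP b a.
  rewrite set_itv_ge ?bnd_simp -?ltNge// Rintegral_set0.
  rewrite (_ : (fun s => _) = cst 0); first exact: is_derive_cst.
  by apply/funext => s; rewrite Rintegral_set0.
pose K := `[t / 2, 2 * t] `*` `[a, b] : set (R * R).
have Kc : compact K by apply: compact_setX; exact: segment_compact.
have K0 : K !=set0 by exists (t, a); split; rewrite /= in_itv/= ?lexx//; apply/andP; split; lra.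
have cK : {within K, continuous (fun q : R * R => `|dt q.1 q.2|)}.
  apply: continuous_in_subspaceT => -[s x] /set_mem [/=]; rewrite !in_itv/= => /andP[ts _] _.
  apply: (@continuous_comp _ _ _ (fun q : R * R => dt q.1 q.2) Num.norm).
    by apply: cdt; lra.
  exact: norm_continuous.
have [[s1 x1] _ maxK] := compact_EVT_max K0 Kc cK.
pose M := `|dt s1 x1|.
have I0 s : `]t / 2, 2 * t[%classic s -> 0 < s by rewrite /= in_itv/= => /andP[]; lra.
have IM s x : `]t / 2, 2 * t[%classic s -> `[a, b]%classic x ->
    `|partial1of2 d s x| <= M.
  move=> sI xI; have s0 := I0 _ sI; rewrite partial1of2E.
  rewrite (@derive_val _ _ _ _ _ _ _ (ddt s x s0)).
  apply: (maxK (s, x)); apply/mem_set; split => //=.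
  by move: sI; rewrite /= !in_itv/= => /andP[h1 h2]; rewrite !ltW.
have tI : `]t / 2, 2 * t[%classic t by rewrite /= in_itv/=; apply/andP; split; lra.
have intM : (@lebesgue_measure R).-integrable `[a, b] (EFin \o cst M).
  exact: (@continuous_integrable_segment _ (cst M) a b (@cst_continuous _ _ _)).
have intd s : `]t / 2, 2 * t[%classic s -> (@lebesgue_measure R).-integrable `[a, b] (EFin \o d s).
  by move=> /I0 s0; apply: continuous_integrable_segment; exact: cd.
have derd s x : `]t / 2, 2 * t[%classic s -> `[a, b]%classic x -> derivable (d ^~ x) s 1.
  by move=> /I0 s0 _; exact: (@ex_derive _ _ _ _ _ _ _ (ddt s x s0)).
have mab : measurable (`[a, b]%classic : set (measurableTypeR R)).
  exact: measurable_itv.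
have M0 (y : R) : 0 <= cst M y by exact: normr_ge0.
have D1 := @derivable_under_integral R _ (measurableTypeR R) (@lebesgue_measure R) _ _ mab _ _ _ tI intd derd (cst M) M0 intM IM.
have D2 := @differentiation_under_integral R _ (measurableTypeR R) (@lebesgue_measure R) _ _ mab _ _ _ tI intd derd (cst M) M0 intM IM.
apply: DeriveDef; first exact: D1.
rewrite -derive1E D2; apply: eq_Rintegral => x _.
by rewrite partial1of2E (@derive_val _ _ _ _ _ _ _ (ddt t x t0)).
Qed.

Lemma is_derive_primitive_param (R : realType) (d dt : R -> R -> R) (t x : R) :
  0 < t -> (forall s : R, 0 < s -> continuous (d s)) ->
  (forall s x : R, 0 < s -> is_derive s (1 : R) (d ^~ x) (dt s x)) ->
  (forall s x : R, 0 < s -> {for (s, x), continuous (fun q : R * R => dt q.1 q.2)}) ->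
  is_derive t (1 : R) (fun s => primitive (d s) x) (primitive (dt t) x).
Proof.
move=> t0 cd ddt cdt; rewrite /primitive; case: ifPn => _.
  exact: is_derive_segment_integral.
have := is_derive_segment_integral x 0 t0 cd ddt cdt => H.
exact: is_deriveN.
Qed.

(** Continuity in each variable becomes joint continuity once one of the two
    dependences is locally Lipschitz, uniformly in the other variable. *)
Lemma lipschitz_joint_continuous (R : realType) (f : R -> R -> R) (t x L r : R) :
  0 < r -> 0 <= L ->
  (forall s y, `|s - t| < r -> `|y - x| < r -> `|f s y - f s x| <= L * `|y - x|) ->
  {for t, continuous (f ^~ x)} ->
  {for (t, x), continuous (fun q : R * R => f q.1 q.2)}.
Proof.
move=> r0 L0 lip ct; apply/cvgrPdist_le => /= e e0.
have /cvgrPdist_le /(_ (e / 2)) := ct; rewrite divr_gt0// => /(_ isT).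
move=> /nbhs_ballP[r1 /= r10 H1].
pose r2 := Num.min r (e / 2 / (L + 1)).
have L1 : 0 < L + 1 by lra.
have r20 : 0 < r2 by rewrite lt_min r0 !divr_gt0.
exists (ball t (Num.min r r1), ball x r2) => /=.
  by split; apply: nbhsx_ballx => //; rewrite lt_min r0.
move=> [s y] /= []; rewrite /ball/= !lt_min => /andP[sr sr1] /andP[yr].
rewrite ltr_pdivlMr// => yr2.
rewrite distrC in yr2; rewrite distrC in sr; rewrite distrC in yr.
have h1 := lip _ _ sr yr; have /= h2 := H1 s sr1.
have -> : f t x - f s y = (f t x - f s x) - (f s y - f s x) by ring.
apply: le_trans (ler_normB _ _) _.
have := normr_ge0 (y - x); nra.
Qed.

Lemma is_derive_derive1 (R : realType) (f : R -> R) (x : R) :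
  derivable f x 1 -> is_derive x (1 : R) f (derive1 f x).
Proof. by move=> fx; apply: DeriveDef; [exact: fx|rewrite derive1E]. Qed.

Lemma continuous_pairL (R : realType) (f : R * R -> R) (t x : R) :
  {for (t, x), continuous f} -> {for t, continuous (fun s => f (s, x))}.
Proof.
move=> cf; apply: (@continuous_comp _ _ _ (fun s : R => (s, x)) f) => //.
exact: (cvg_pair cvg_id (cvg_cst x)).
Qed.

(** * Uniqueness for Burgers' equation *)

Section uniqueness.
Context (R : realType) (u0 : R -> R) (u v : R -> R -> R).
Hypothesis su : burgers_solution u0 u.
Hypothesis sv : burgers_solution u0 v.

(** The difference d = u - v satisfies d_t = F_x with F = d_x - (u^2 - v^2) / 2,
    hence E_t (t,x) = F (t,x) - F (t,0) for the potential E of d, and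
    F = E_xx - a E_x. *)
Let d t x := u t x - v t x.
Let dt t x := derive1 (u ^~ x) t - derive1 (v ^~ x) t.
Let dx t x := derive1 (u t) x - derive1 (v t) x.
Let dxx t x := derive1 (derive1 (u t)) x - derive1 (derive1 (v t)) x.
Let a t x := (u t x + v t x) / 2.
Let F t x := dx t x - (u t x * u t x - v t x * v t x) / 2.
Let E t x := primitive (d t) x.

Let d_t (t x : R) : 0 < t -> is_derive t (1 : R) (d ^~ x) (dt t x).
Proof.
move=> t0; have := is_derive_derive1 (burgers_derivable_t su t0) => ?.
have := is_derive_derive1 (burgers_derivable_t sv t0) => ?.
exact: is_deriveB.
Qed.

Let d_x (t x : R) : 0 < t -> is_derive x (1 : R) (d t) (dx t x).
Proof.
move=> t0; have := is_derive_derive1 (burgers_derivable_x su t0) => ?.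
have := is_derive_derive1 (burgers_derivable_x sv t0) => ?.
exact: is_deriveB.
Qed.

Let dx_x (t x : R) : 0 < t -> is_derive x (1 : R) (dx t) (dxx t x).
Proof.
move=> t0; have := is_derive_derive1 (burgers_derivable_xx su t0) => ?.
have := is_derive_derive1 (burgers_derivable_xx sv t0) => ?.
exact: is_deriveB.
Qed.

Let F_x (t x : R) : 0 < t -> is_derive x (1 : R) (F t) (dt t x).
Proof.
move=> t0; have hu := is_derive_derive1 (burgers_derivable_x su t0).
have hv := is_derive_derive1 (burgers_derivable_x sv t0).
have hdx := dx_x x t0.
apply: is_derive_eq; rewrite /GRing.scale/= /dxx /dt.
have := burgers_eq su x t0; have := burgers_eq sv x t0.
by move=> <- <-; field.
Qed.

Let cd (t : R) : 0 < t -> continuous (d t).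
Proof.
by move=> t0 x; apply: continuousB; [exact: (solution_continuous su)|exact: (solution_continuous sv)].
Qed.

Let cdt (t x : R) : 0 < t -> {for (t, x), continuous (fun q : R * R => dt q.1 q.2)}.
Proof.
move=> t0.
have [_ h1 _ _] := @burgers_continuous _ _ _ su (t, x) t0.
have [_ h2 _ _] := @burgers_continuous _ _ _ sv (t, x) t0.
exact: (continuousB h1 h2).
Qed.

Let cF (t x : R) : 0 < t -> {for (t, x), continuous (fun q : R * R => F q.1 q.2)}.
Proof.
move=> t0.
have [h1 _ h3 _] := @burgers_continuous _ _ _ su (t, x) t0.
have [k1 _ k3 _] := @burgers_continuous _ _ _ sv (t, x) t0.
apply: continuousB; first exact: (continuousB h3 k3).
apply: continuousM; last exact: cst_continuous.
by apply: continuousB; [exact: (continuousM h1 h1)|exact: (continuousM k1 k1)].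
Qed.

Let cdtx (t : R) : 0 < t -> continuous (dt t).
Proof.
move=> t0 x; apply: (@continuous_comp _ _ _ (fun y : R => (t, y)) (fun q : R * R => dt q.1 q.2)).
  exact: (cvg_pair (cvg_cst t) cvg_id).
exact: cdt.
Qed.

Let E_t (t x : R) : 0 < t -> is_derive t (1 : R) (E ^~ x) (F t x - F t 0).
Proof.
move=> t0; have <- : primitive (dt t) x = F t x - F t 0.
  by apply: primitive_diff => [|y]; [exact: cdtx|exact: F_x].
by apply: is_derive_primitive_param.
Qed.

Let E_x (t x : R) : 0 < t -> is_derive x (1 : R) (E t) (d t x).
Proof. by move=> t0; apply: is_derive_primitive; exact: cd. Qed.

Let E_cvg0 (x : R) : E t x @[t --> 0^'+] --> 0.
Proof.
have [g ig gP] := primitive_pairing x.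
have hu := burgers_initial su ig; have hv := burgers_initial sv ig.
have ib (w : R -> R -> R) (t : R) : burgers_solution u0 w -> 0 < t ->
    (@lebesgue_measure R).-integrable [set: R] (EFin \o (fun y => w t y * g y)).
  move=> sw t0; have [M _ HM] := solution_bounded sw t.
  apply: (integrableMr measurableT _ _ ig).
    exact: continuous_measurable_fun (solution_continuous sw t0).
  exists M; split; first exact: num_real.
  by move=> N MN y _ /=; apply: le_trans (ltW MN); apply: HM; rewrite t0 lexx.
have EE (t : R) : 0 < t -> E t x = \int[lebesgue_measure]_y (u t y * g y) -
    \int[lebesgue_measure]_y (v t y * g y).
  move=> t0; rewrite /E gP; last exact: cd.
  rewrite -RintegralB//; [|exact: ib|exact: ib].
  by apply: eq_Rintegral => y _; rewrite /d mulrBl.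
have /cvgrPdist_le H : (\int[lebesgue_measure]_y (u t y * g y) -
    \int[lebesgue_measure]_y (v t y * g y)) @[t --> (0 : R)^'+] --> (0 : R).
  rewrite -[X in _ --> X](subrr (\int[lebesgue_measure]_y (u0 y * g y))).
  exact: (cvgB hu hv).
apply/cvgrPdist_le => e e0; near=> t; rewrite EE; last first.
  by near: t; exact: nbhs_right_gt.
by near: t; exact: H.
Unshelve. all: by end_near. Qed.

Let cE (t x : R) : 0 < t -> {for (t, x), continuous (fun q : R * R => E q.1 q.2)}.
Proof.
move=> t0.
have [M M0 uM] := solution_bounded su (2 * t).
have [N N0 vN] := solution_bounded sv (2 * t).
apply: (@lipschitz_joint_continuous _ _ _ _ (M + N) t) => //.
- exact: addr_ge0.
- move=> s y st _; have /ltr_normlP[s1 s2] := st.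
  apply: primitive_lipschitz; first by apply: cd; lra.
  by move=> z; apply: le_trans (ler_normB _ _) _; apply: lerD; [apply: uM|apply: vN]; apply/andP; split; lra.
- exact: (is_derive_continuous (E_t x t0)).
Qed.

(** At each x the weak-* initial condition gives E (s,x) -> 0.  The Lipschitz
    bound in x makes this uniform on compact sets, and outside a large compact
    set the linear growth of E is below e x^2. *)
Let E_small (e : R) : 0 < e -> \forall s \near 0^'+, forall x, `|E s x| <= e * (1 + x ^+ 2).
Proof.
move=> e0.
have [M M0 uM] := solution_bounded su 1.
have [N N0 vN] := solution_bounded sv 1.
have lip (s : R) : 0 < s <= 1 -> forall x y, `|E s x - E s y| <= (M + N) * `|x - y|.
  move=> s01; apply: primitive_lipschitz; first by apply: cd; case/andP: s01.
  by move=> z; apply: le_trans (ler_normB _ _) _; apply: lerD; [exact: uM|exact: vN].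
have E0 s : E s 0 = 0 by exact: primitive0.
have MN0 : 0 <= M + N by exact: addr_ge0.
pose K := (M + N) / e.
have K0 : 0 <= K by rewrite divr_ge0// ltW.
pose P (s x : R) := 0 < s <= 1 -> `|E s x| <= e.
have cover x : `[- K, K]%classic x -> \forall x' \near x & s \near 0^'+, P s x'.
  move=> _; have /cvgrPdist_le /(_ (e / 2)) := E_cvg0 x.
  rewrite divr_gt0// => /(_ isT) H.
  pose r := e / 2 / (M + N + 1).
  have r0 : 0 < r by rewrite !divr_gt0//; lra.
  exists (ball x r, [set s | `|0 - E s x| <= e / 2]).
    by split; [exact: nbhsx_ballx|exact: H].
  move=> [x' s] /= []; rewrite /ball/= sub0r normrN ltr_pdivlMr; last by lra.
  move=> xx' Es s01; have := lip _ s01 x' x; rewrite [`|x' - x|]distrC => L.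
  rewrite -(subrK (E s x) (E s x')); apply: le_trans (ler_normD _ _) _.
  by have := normr_ge0 (x - x'); nra.
have /compact_near_coveringP := @segment_compact R (- K) K.
move=> /(_ R 0^'+ P _ cover) H; near=> s.
have s0 : 0 < s by near: s; exact: nbhs_right_gt.
have s1 : s <= 1 by near: s; exact: nbhs_right_le.
have s01 : 0 < s <= 1 by rewrite s0.
move=> x; have [xK|Kx] := lerP `|x| K.
  have PK : P s x by apply: (near H s) => //; rewrite /= in_itv/= -ler_norml.
  by apply: le_trans (PK s01) _; rewrite ler_peMr ?(ltW e0)// lerDl sqr_ge0.
have := lip _ s01 x 0; rewrite E0 !subr0 => /le_trans; apply.
rewrite -(real_normK (num_real x)).
have : M + N = K * e by rewrite /K divfK// gt_eqF.
move=> ->; move: Kx (normr_ge0 x); move: (`|x|) => n Kn n0.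
have h : 0 <= e * n * (n - K) by rewrite !mulr_ge0 ?subr_ge0// ltW.
by nra.
Unshelve. all: by end_near. Qed.

(** D (t,x) = E (t,x) + c t, with c' = F (.,0), solves D_t + a D_x = D_xx.
    Comparison applied to D and to - D on [s, T], with s small, shows that
    E (T,x) + c T is small; at x = 0 this bounds c T, hence E (T,x). *)
Let E_eq0 (T x : R) : 0 < T -> E T x = 0.
Proof.
move=> T0.
have [M M0 uM] := solution_bounded su T.
have [N N0 vN] := solution_bounded sv T.
have MN0 : 0 <= M + N by exact: addr_ge0.
pose C := expR ((3 + (M + N)) * T) * (2 + x ^+ 2).
have C0 : 0 < C by rewrite mulr_gt0 ?expR_gt0//; have := sqr_ge0 x; lra.
suff bound e : 0 < e -> `|E T x| <= e * C.
  apply/eqP; rewrite -normr_eq0; apply/eqP/le_anti; rewrite normr_ge0 andbT.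
  apply/ler_addgt0Pr => e e0; rewrite add0r.
  by have := bound (e / C); rewrite divr_gt0// divfK ?gt_eqF//; apply.
move=> e0; near (0 : R)^'+ => s.
have s0 : 0 < s by near: s; exact: nbhs_right_gt.
have sT : s <= T by near: s; exact: nbhs_right_le.
have Es : forall x, `|E s x| <= e * (1 + x ^+ 2) by near: s; exact: E_small.
(* F (.,0) is only controlled for positive times; freezing it before s makes it
   continuous everywhere without changing it on [s, T]. *)
pose f r := F (Num.max r s) 0.
have cf : continuous f.
  move=> r; apply: (@continuous_comp _ _ _ (fun r : R => Num.max r s) (fun r => F r 0)).
    by apply: continuous_max => //; exact: cst_continuous.
  apply: (@continuous_pairL _ (fun q => F q.1 q.2)); apply: cF.
  by rewrite lt_max s0 orbT.
pose c r := primitive f r - primitive f s.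
have c_t t : s < t <= T -> is_derive t (1 : R) c (F t 0).
  move=> /andP[st _]; have H := is_derive_primitive t cf.
  by apply: is_derive_eq; rewrite subr0 /f max_l// ltW.
have pos t : s <= t <= T -> 0 < t by move=> /andP[st _]; exact: lt_le_trans st.
have pos' t : s < t <= T -> 0 < t by move=> /andP[st _]; exact: lt_trans st.
have cc : continuous c.
  move=> r; apply: continuousB; last exact: cst_continuous.
  exact: (is_derive_continuous (is_derive_primitive r cf)).
have [c1 _ cmax] := @EVT_max _ (fun r => `|c r|) _ _ sT
  (continuous_subspaceT (fun r => @continuous_comp _ _ _ c Num.norm r (cc r) (@norm_continuous _ _ _))).
have ge t y : s <= t <= T -> `|E t y| <= (M + N) * `|y|.
  move=> tI; rewrite -[y in X in _ <= X]subr0 -[E t y]subr0.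
  have -> : (0 : R) = E t 0 by rewrite /E primitive0.
  rewrite {3}/E primitive0.
  apply: primitive_lipschitz; first by apply: cd; exact: pos.
  move=> z; apply: le_trans (ler_normB _ _) _.
  by apply: lerD; [apply: uM|apply: vN]; rewrite (pos _ tI) (andP tI).2.
have aMN t y : s < t <= T -> `|a t y| <= M + N.
  move=> tI; have tT : 0 < t <= T by rewrite (pos' _ tI) (andP tI).2.
  have := uM t y tT; have := vN t y tT; have := ler_normD (u t y) (v t y).
  rewrite /a normrM [`|2^-1|]ger0_norm ?invr_ge0//; have := normr_ge0 (u t y + v t y); lra.
have cs : c s = 0 by rewrite /c subrr.
pose B := `|c c1|.
have cB t : s <= t <= T -> `|c t| <= B by move=> tI; apply: cmax; rewrite in_itv.
have sTT : s <= T <= T by rewrite sT lexx.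
have main (k : R) : k = 1 \/ k = -1 ->
    forall y, k * (E T y + c T) <= e * expR ((3 + (M + N)) * (T - s)) * (1 + y ^+ 2).
  move=> k1 y.
  have kk z : k * z <= `|z|.
    case: k1 => ->; first by rewrite mul1r ler_norm.
    by rewrite mulN1r -normrN ler_norm.
  apply: (@parabolic_comparison _ (fun t y => k * (E t y + c t)) a
    (fun t y => k * F t y) (fun t y => k * d t y) (fun t y => k * dx t y) s T (M + N) (M + N + B)) => //.
  - by rewrite addr_ge0//; exact: normr_ge0.
  - move=> t z tI; apply: continuousM; first exact: cst_continuous.
    apply: continuousD; first by apply: cE; exact: pos.
    apply: (@continuous_comp _ _ _ fst c); last exact: cc.
    exact: cvg_fst.
  - move=> t z tI; have h1 := E_t z (pos' _ tI); have h2 := c_t _ tI.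
    by apply: is_derive_eq; rewrite /GRing.scale/=; ring.
  - move=> t z tI; have h1 := E_x z (pos' _ tI).
    by apply: is_derive_eq; rewrite /GRing.scale/=; ring.
  - move=> t z tI; have h1 := dx_x z (pos' _ tI).
    by have h2 := d_x z (pos' _ tI); apply: is_derive_eq; rewrite /GRing.scale/=; ring.
  - by move=> t z tI; rewrite /F /a /d; ring.
  - move=> t z tI; apply: le_trans (kk _) _; apply: le_trans (ler_normD _ _) _.
    have := ge t z tI; have := cB t tI; have B0 : 0 <= B by exact: normr_ge0.
    by have := normr_ge0 z; nra.
  - by move=> z; apply: le_trans (kk _) _; rewrite cs addr0.
have [m1 m2] := (main 1 (or_introl erefl), main (-1) (or_intror erefl)).
have ET0 : E T 0 = 0 by exact: primitive0.
have := (m1 x, m1 0, m2 x, m2 0) => -[[[]]]; rewrite ET0 !mul1r !mulN1r.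
set b := e * expR _.
have bC : b * (2 + x ^+ 2) <= e * C.
  rewrite /b /C -mulrA ler_pM2l// ler_pM2r; last by have := sqr_ge0 x; lra.
  by rewrite ler_expR ler_wpM2l//; lra.
move=> h1 h2 h3 h4; apply: le_trans bC; apply/ler_normlP; split; nra.
Unshelve. all: by end_near. Qed.

Lemma burgers_unique (t x : R) : 0 < t -> u t x = v t x.
Proof.
move=> t0; apply/eqP; rewrite -subr_eq0; apply/eqP.
have E0 : E t = cst 0 by apply/funext => y; exact: E_eq0.
have := @derive_val _ _ _ _ _ _ _ (E_x x t0).
by rewrite E0 derive_cst.
Qed.
End uniqueness.

(** * Derivatives of the heat kernel *)

Section heat_kernel.
Context (R : realType).

Definition heat (s z : R) : R := expR (- (ln s / 2) - z ^+ 2 / (4 * s)).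

(** The i-th derivative of the kernel in z, through the three-term recurrence of
    the Hermite polynomials.  By the heat equation, a derivative in s is the
    same as two derivatives in z. *)
Fixpoint heat_deriv (i : nat) (s z : R) : R :=
  match i with
  | 0 => heat s z
  | j.+1 =>
    match j with
    | 0 => - (z / (2 * s) * heat s z)
    | k.+1 => - (z / (2 * s) * heat_deriv j s z + k.+1%:R / (2 * s) * heat_deriv k s z)
    end
  end.

Arguments heat_deriv : simpl never.

Lemma heat_deriv0 s z : heat_deriv 0 s z = heat s z.
Proof. by []. Qed.

Lemma heat_deriv1 s z : heat_deriv 1 s z = - (z / (2 * s) * heat s z).
Proof. by []. Qed.

Lemma heat_derivSS i s z : heat_deriv i.+2 s z =
  - (z / (2 * s) * heat_deriv i.+1 s z + i.+1%:R / (2 * s) * heat_deriv i s z).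
Proof. by []. Qed.

Lemma heat_gt0 s z : 0 < heat s z. Proof. exact: expR_gt0. Qed.

Lemma is_derive_heat_z (s z : R) : 0 < s ->
  is_derive z (1 : R) (heat s) (heat_deriv 1 s z).
Proof.
move=> s0; rewrite /heat.
have dE : is_derive z (1 : R) (fun y => - (ln s / 2) - y ^+ 2 / (4 * s)) (- (z / (2 * s))).
  apply: is_derive_eq; rewrite /GRing.scale/=; field; exact: lt0r_neq0.
have := is_derive1_comp (is_derive_expR _) dE; rewrite /comp/= => H.
by apply: is_derive_eq; rewrite heat_deriv1 /heat; ring.
Qed.

Lemma is_derive_heat_s (s z : R) : 0 < s ->
  is_derive s (1 : R) (heat ^~ z) (heat_deriv 2 s z).
Proof.
move=> s0; rewrite /heat.
have s40 : 4 * s != 0 by rewrite mulf_neq0 ?lt0r_neq0.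
have dln := is_derive1_ln s0.
have dV : is_derive s (1 : R) (fun y => (4 * y)^-1) (- (4 * s) ^- 2 * 4).
  by apply: is_derive_eq; rewrite /GRing.scale/=; ring.
have dE : is_derive s (1 : R) (fun y => - (ln y / 2) - z ^+ 2 / (4 * y))
    ((z / (2 * s)) ^+ 2 - 1 / (2 * s)).
  apply: is_derive_eq; rewrite /GRing.scale/=; field; exact: lt0r_neq0.
have := is_derive1_comp (is_derive_expR _) dE; rewrite /comp/= => H.
by apply: is_derive_eq; rewrite heat_derivSS heat_deriv1 heat_deriv0 /heat; field; exact: lt0r_neq0.
Qed.

Lemma is_derive_heat_deriv_z i (s z : R) : 0 < s ->
  is_derive z (1 : R) (heat_deriv i s) (heat_deriv i.+1 s z).
Proof.
move=> s0.
have dv : is_derive z (1 : R) (fun y => y / (2 * s)) ((2 * s)^-1).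
  by apply: is_derive_eq; rewrite /GRing.scale/=; ring.
suff [] : is_derive z (1 : R) (heat_deriv i s) (heat_deriv i.+1 s z) /\
  is_derive z (1 : R) (heat_deriv i.+1 s) (heat_deriv i.+2 s z) by [].
elim: i => [|i [IH1 IH2]].
  split; first exact: is_derive_heat_z.
  have dh := is_derive_heat_z z s0.
  have H : is_derive z (1 : R) (fun y => - (y / (2 * s) * heat s y)) (heat_deriv 2 s z).
    by apply: is_derive_eq; rewrite heat_derivSS heat_deriv1 ?heat_deriv0 /GRing.scale/=; ring.
  exact: H.
split=> //.
have H : is_derive z (1 : R) (fun y => - (y / (2 * s) * heat_deriv i.+1 s y +
    i.+1%:R / (2 * s) * heat_deriv i s y)) (heat_deriv i.+3 s z).
  apply: is_derive_eq; rewrite [in RHS]heat_derivSS -[i.+2%:R]natr1 /GRing.scale/=.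
  by field; exact: lt0r_neq0.
exact: H.
Qed.

Lemma is_derive_heat_deriv_s i (s z : R) : 0 < s ->
  is_derive s (1 : R) (heat_deriv i ^~ z) (heat_deriv i.+2 s z).
Proof.
move=> s0.
have s20 : 2 * s != 0 by rewrite mulf_neq0 ?lt0r_neq0.
have dv : is_derive s (1 : R) (fun y => z / (2 * y)) (- (z / (2 * s) / s)).
  by apply: is_derive_eq; rewrite /GRing.scale/=; field; exact: lt0r_neq0.
have dk k : is_derive s (1 : R) (fun y => k / (2 * y)) (- (k / (2 * s) / s)).
  by apply: is_derive_eq; rewrite /GRing.scale/=; field; exact: lt0r_neq0.
suff [] : is_derive s (1 : R) (heat_deriv i ^~ z) (heat_deriv i.+2 s z) /\
  is_derive s (1 : R) (heat_deriv i.+1 ^~ z) (heat_deriv i.+3 s z) by [].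
elim: i => [|i [IH1 IH2]].
  split; first exact: is_derive_heat_s.
  have dh := is_derive_heat_s z s0.
  have H : is_derive s (1 : R) (fun y => - (z / (2 * y) * heat y z)) (heat_deriv 3 s z).
    apply: is_derive_eq; rewrite [in RHS]heat_derivSS heat_deriv1 ?heat_deriv0 /GRing.scale/=.
    by field; exact: lt0r_neq0.
  exact: H.
split=> //.
have dki := dk i.+1%:R.
have H : is_derive s (1 : R) (fun y => - (z / (2 * y) * heat_deriv i.+1 y z +
    i.+1%:R / (2 * y) * heat_deriv i y z)) (heat_deriv i.+4 s z).
  apply: is_derive_eq; rewrite [in RHS]heat_derivSS [in RHS](heat_derivSS i).
  rewrite (heat_derivSS i.+1) (heat_derivSS i).
  rewrite -[i.+3%:R]natr1 -[i.+2%:R]natr1 /GRing.scale/=.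
  by field; exact: lt0r_neq0.
exact: H.
Qed.

(** In the variable v = z / (2 s) the i-th derivative is the kernel times a
    polynomial of degree i, and |v| <= exp |v|. *)
Lemma heat_deriv_bound i (s z : R) : 1 <= s ->
  `|heat_deriv i s z| <= i`!%:R * expR (i%:R * `|z / (2 * s)|) * heat s z.
Proof.
move=> s1; set v := z / (2 * s).
have h0 := heat_gt0 s z.
have v0 : 0 <= `|v| by exact: normr_ge0.
have ve : `|v| <= expR `|v| by have := expR_ge1Dx `|v|; lra.
have e1 : 1 <= expR `|v| by have := expR_ge1Dx `|v|; lra.
pose b j := j`!%:R * expR (j%:R * `|v|) * heat s z.
suff [] : `|heat_deriv i s z| <= b i /\ `|heat_deriv i.+1 s z| <= b i.+1 by [].
elim: i => [|i [IH1 IH2]].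
  rewrite /b fact0 factS fact0 muln1 !mul0r expR0 !mul1r heat_deriv0.
  rewrite (gtr0_norm h0); split=> //.
  by rewrite heat_deriv1 normrN normrM (gtr0_norm h0) ler_pM2r.
split=> //; rewrite heat_derivSS normrN; apply: le_trans (ler_normD _ _) _.
rewrite -/v (normrM v) (normrM (_ / _)) (normrM i.+1%:R).
have eE (j : nat) : expR (j.+1%:R * `|v|) = expR `|v| * expR (j%:R * `|v|).
  by rewrite -expRD; congr expR; rewrite -natr1; ring.
set E := expR (i%:R * `|v|).
have E0 : 0 < E by exact: expR_gt0.
have k0 : 0 <= i.+1%:R :> R by [].
have half : `|(2 * s)^-1| <= 1 / 2.
  rewrite ger0_norm ?invr_ge0; last by lra.
  by rewrite -[leLHS]mul1r ler_pdivrMr; lra.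
have step1 : `|v| * `|heat_deriv i.+1 s z| <= expR `|v| * b i.+1 by apply: ler_pM.
have step2 : `|i.+1%:R| * `|(2 * s)^-1| * `|heat_deriv i s z| <=
    i.+1%:R * (1 / 2) * b i.
  rewrite (ger0_norm k0); by apply: ler_pM => //; apply: ler_wpM2l.
apply: le_trans (lerD step1 step2) _.
have f0 : 0 < i`!%:R :> R by rewrite ltr0n fact_gt0.
pose Q := i.+1%:R * i`!%:R * E * heat s z.
have Q0 : 0 <= Q by rewrite /Q !mulr_ge0// ltW.
have -> : expR `|v| * b i.+1 = expR `|v| * expR `|v| * Q.
  by rewrite /b eE factS natrM /Q /E; ring.
have -> : i.+1%:R * (1 / 2) * b i = 1 / 2 * Q by rewrite /b /Q /E; ring.
have -> : b i.+2 = i.+2%:R * (expR `|v| * expR `|v|) * Q.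
  by rewrite /b eE eE !factS !natrM /Q /E; ring.
have i2 : 2 <= i.+2%:R :> R by rewrite ler_nat.
have ee : 1 <= expR `|v| * expR `|v| by rewrite -[leLHS]mulr1 ler_pM.
move: (expR `|v| * expR `|v|) ee => X X1.
have : 1 / 2 + X <= i.+2%:R * X by nra.
by move=> h; rewrite -mulrDl; apply: ler_wpM2r => //; lra.
Qed.

Lemma heat_le (s z : R) : 0 < s -> heat s z <= expR (- (ln s / 2)).
Proof.
by move=> s0; rewrite /heat ler_expR gerBl divr_ge0 ?sqr_ge0// mulr_ge0// ltW.
Qed.
End heat_kernel.
Arguments heat_deriv : simpl never.

(** * Series as integrals for the counting measure *)

Section counting.
Context (R : realType).
Notation count := (@counting nat R).

Lemma integrable_counting (a : nat -> R) (B : R) : (forall n, 0 <= a n) ->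
  (forall n, \sum_(0 <= k < n) a k <= B) -> count.-integrable [set: nat] (EFin \o a).
Proof.
move=> a0 aB; apply/integrableP; split=> //.
under eq_integral do rewrite gee0_abs ?lee_fin//=.
rewrite ge0_integral_count; last by move=> k; rewrite lee_fin.
apply: (@le_lt_trans _ _ B%:E); last by rewrite ltry.
apply: lime_le; first by apply: is_cvg_nneseries => k _ _; rewrite lee_fin.
by apply: nearW => n; rewrite sumEFin lee_fin.
Qed.

Lemma le_integrable_counting (f G : nat -> R) : count.-integrable [set: nat] (EFin \o G) ->
  (forall n, `|f n| <= G n) -> count.-integrable [set: nat] (EFin \o f).
Proof.
move=> iG fG; apply: le_integrable iG => // n _ /=.
by rewrite lee_fin (le_trans (fG n))// ler_norm.
Qed.

Lemma Rintegral_counting_bound (f G : nat -> R) : count.-integrable [set: nat] (EFin \o G) ->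
  (forall n, `|f n| <= G n) -> `| \int[count]_n f n | <= \int[count]_n G n.
Proof.
move=> iG fG; have If := le_integrable_counting iG fG.
apply: le_trans (le_normr_Rintegral _ If) _ => //.
by apply: le_Rintegral => //; exact: integrable_norm.
Qed.

Lemma integrable_geometric : count.-integrable [set: nat] (EFin \o (fun n => expR (- n%:R))).
Proof.
apply: (@integrable_counting _ 2) => [n|n]; first exact: expR_ge0.
have e2 : expR (-1) <= 1 / 2 :> R.
  have e1 : 2 <= expR 1 :> R by have := expR_ge1Dx (1 : R); lra.
  by rewrite expRN -[leLHS]mul1r ler_pdivrMr ?expR_gt0//; lra.
suff : \sum_(0 <= k < n) expR (- k%:R) <= 2 - 2 * expR (- n%:R) :> R.
  by have := expR_gt0 (- n%:R : R); lra.
elim: n => [|n IH]; first by rewrite big_nil oppr0 expR0; lra.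
rewrite big_nat_recr//=; apply: le_trans (lerD IH (lexx _)) _.
rewrite -[n.+1%:R]natr1 opprD expRD; have := expR_gt0 (- n%:R : R).
move: (expR (- n%:R)) => x x0; nra.
Qed.
End counting.

(** * Superpositions of Gaussians *)

(** A Gaussian centred at 4 T whose width parameter is at least T has a bounded
    logarithmic derivative on bounded sets, uniformly in T. *)
Lemma slope_bound (R : realType) (T t x X : R) : 2 <= T -> -1 < t -> `|x| <= X ->
  `|(x - 4 * T) / (2 * (T + 1 + t))| <= X + 2.
Proof.
move=> T2 t1 xX; have /ler_normlP[x1 x2] := xX.
have X0 : 0 <= X by apply: le_trans xX.
rewrite normf_div [`|2 * _|]ger0_norm; last by lra.
rewrite ler_pdivrMr; last by lra.
by apply/ler_normlP; split; nra.
Qed.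

Section gaussian_sum.
Context (R : realType) (tau : nat -> R).
Hypothesis tau_ge : forall n, n%:R + 2 <= tau n.
Notation count := (@counting nat R).

Let tau_ge2 n : 2 <= tau n.
Proof. by apply: le_trans (tau_ge n); rewrite lerDr. Qed.

Definition gauss_term (i n : nat) (t x : R) : R :=
  expR (2 * tau n + ln (tau n) / 2) * heat_deriv i (tau n + 1 + t) (x - 4 * tau n).

(** Written as an integral for the counting measure, the series can be
    differentiated term by term by differentiation under the integral sign. *)
Definition gauss_sum (i : nat) (t x : R) : R := \int[count]_n gauss_term i n t x.

Lemma gauss_term_gt0 n (t x : R) : 0 < gauss_term 0 n t x.
Proof. by rewrite mulr_gt0 ?expR_gt0// heat_gt0. Qed.

Lemma gauss_term_le n (t x : R) : -1 < t ->
  gauss_term 0 n t x <=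
  expR (2 * tau n - (x - 4 * tau n) ^+ 2 / (4 * (tau n + 1 + t))).
Proof.
move=> t1; have T2 := tau_ge2 n.
rewrite /gauss_term heat_deriv0 /heat -expRD ler_expR.
have : ln (tau n) <= ln (tau n + 1 + t) by rewrite ler_ln ?posrE; lra.
lra.
Qed.

Lemma gauss_term_bound i n (t x : R) : -1 < t ->
  `|gauss_term i n t x| <=
  i`!%:R * expR (i%:R * `|(x - 4 * tau n) / (2 * (tau n + 1 + t))|) * gauss_term 0 n t x.
Proof.
move=> t1; have T2 := tau_ge2 n.
rewrite /gauss_term normrM (gtr0_norm (expR_gt0 _)) [leRHS]mulrCA heat_deriv0.
by rewrite ler_pM2l ?expR_gt0//; apply: heat_deriv_bound; lra.
Qed.

(** The amplitude exp (2 T) loses against the tail exp (- 4 T) that a Gaussian of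
    width T centred at 4 T has near the origin, which leaves exp (- 2 T). *)
Lemma gauss_term_local i n (t x T X : R) : -1 < t <= T -> `|x| <= X ->
  `|gauss_term i n t x| <=
  i`!%:R * expR (i%:R * (X + 2) + 4 * (T + 1) + 2 * X) * expR (- (2 * tau n)).
Proof.
move=> /andP[t1 tT] xX; have T2 := tau_ge2 n.
have /ler_normlP[x1 x2] := xX.
have X0 : 0 <= X by apply: le_trans xX.
apply: le_trans (gauss_term_bound i n x t1) _.
rewrite -!mulrA ler_wpM2l// -expRD.
apply: (@le_trans _ _ (expR (i%:R * (X + 2)) *
   expR (4 * (T + 1) + 2 * X - 2 * tau n))); last first.
  by rewrite -expRD ler_expR; lra.
apply: ler_pM; [exact: expR_ge0|exact/ltW/gauss_term_gt0| |].
  by rewrite ler_expR ler_wpM2l//; exact: slope_bound.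
apply: le_trans (gauss_term_le n x t1) _.
rewrite ler_expR lerBlDr -lerBlDl.
rewrite ler_pdivlMr; last by lra.
have [h|h] := leP (4 * tau n - 4 * (T + 1) - 2 * X) 0.
  by apply: (@le_trans _ _ 0); [nra|exact: sqr_ge0].
have h1 : 0 <= (4 * tau n - 4 * (T + 1) - 2 * X) * (4 * (T - t)) by apply: mulr_ge0; lra.
have h2 : 0 <= (tau n) * (X - x) by apply: mulr_ge0; lra.
have h3 : 0 <= X * (T + 1) by apply: mulr_ge0; lra.
have := sqr_ge0 x; have := sqr_ge0 (T + 1); nra.
Qed.

(** Where the logarithmic slope v is at most 4 + i, the derivative is controlled
    by the term itself; where v is larger, x is so far from the centre that
    the decay exp (- s v^2) absorbs both exp (i v) and the amplitude. *)
Lemma gauss_term_global i n (t x : R) : -1 < t ->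
  `|gauss_term i n t x| <=
  i`!%:R * expR (i%:R * (4 + i%:R)) * (gauss_term 0 n t x + expR (- (2 * tau n))).
Proof.
move=> t1; have T2 := tau_ge2 n.
apply: le_trans (gauss_term_bound i n x t1) _.
rewrite -!mulrA ler_wpM2l//.
set s := tau n + 1 + t; set v := `| _ |.
have i0 : 0 <= i%:R :> R by [].
have v0 : 0 <= v by exact: normr_ge0.
have K1 : 1 <= expR (i%:R * (4 + i%:R) : R).
  by rewrite -expR0 ler_expR mulr_ge0// addr_ge0.
have G0 := gauss_term_gt0 n t x; have e0 := expR_gt0 (- (2 * tau n)).
have [vB|Bv] := leP v (4 + i%:R).
  apply: ler_pM; [exact: expR_ge0|exact: ltW| |by rewrite lerDl ltW].
  by rewrite ler_expR ler_wpM2l.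
apply: (@le_trans _ _ (expR (- (2 * tau n)))); last first.
  by move: K1 G0 e0; move: (expR (_ * (4 + _))) (gauss_term _ _ _ _) => K G; nra.
apply: le_trans (ler_wpM2l (expR_ge0 _) (gauss_term_le n x t1)) _.
rewrite -expRD ler_expR -/s.
have s2 : 2 <= s by rewrite /s; lra.
have -> : (x - 4 * tau n) ^+ 2 / (4 * s) = s * v ^+ 2.
  rewrite /v real_normK ?num_real//; field; apply: lt0r_neq0; lra.
have st : tau n <= s by rewrite /s; lra.
clearbody s v.
have h1 : 0 <= s * v * (v - (4 + i%:R)).
  by rewrite !mulr_ge0 ?subr_ge0 ?(ltW Bv)//; lra.
have h2 : 0 <= (s - 1) * (i%:R * v) by rewrite !mulr_ge0//; lra.
have h3 : 0 <= s * (v - 4) by apply: mulr_ge0; lra.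
nra.
Qed.

Let exp_tau n : expR (- (2 * tau n)) <= expR (- n%:R).
Proof. by have := tau_ge n; have : 0 <= n%:R :> R by []; rewrite ler_expR; lra. Qed.

Let local_const (i : nat) (T X : R) : R :=
  i`!%:R * expR (i%:R * (X + 2) + 4 * (T + 1) + 2 * X).

Let local_const_ge0 i T X : 0 <= local_const i T X.
Proof. by rewrite mulr_ge0 ?expR_ge0. Qed.

Let gauss_term_local' i n (t x T X : R) : -1 < t <= T -> `|x| <= X ->
  `|gauss_term i n t x| <= local_const i T X * expR (- n%:R).
Proof.
move=> tT xX; apply: le_trans (gauss_term_local i n tT xX) _.
exact: ler_wpM2l.
Qed.

Let integrable_local C : count.-integrable [set: nat] (EFin \o (fun n => C * expR (- n%:R))).
Proof. exact: (integrableZl measurableT C (@integrable_geometric R)). Qed.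

Lemma integrable_gauss_term i (t x : R) : -1 < t ->
  count.-integrable [set: nat] (EFin \o (fun n => gauss_term i n t x)).
Proof.
move=> t1; apply: (le_integrable_counting (integrable_local (local_const i t `|x|))) => n.
by apply: gauss_term_local'; rewrite ?t1 ?lexx.
Qed.

Let geom : R := \int[count]_n expR (- n%:R).

Let geom_ge0 : 0 <= geom. Proof. by apply: Rintegral_ge0 => n _; exact: expR_ge0. Qed.

Lemma is_derive_gauss_term_x i n (t x : R) : -1 < t ->
  is_derive x (1 : R) (gauss_term i n t) (gauss_term i.+1 n t x).
Proof.
move=> t1; have s0 : 0 < tau n + 1 + t by have := tau_ge2 n; lra.
have dz : is_derive x (1 : R) (fun y => y - 4 * tau n) 1.
  by apply: is_derive_eq; rewrite subr0.
have dh := is_derive_heat_deriv_z i (x - 4 * tau n) s0.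
have dc := @is_derive1_comp _ (heat_deriv i (tau n + 1 + t)) (fun y => y - 4 * tau n) _ _ _ dh dz; rewrite mulr1 in dc.
exact: is_deriveZ.
Qed.

Lemma is_derive_gauss_term_t i n (t x : R) : -1 < t ->
  is_derive t (1 : R) (gauss_term i n ^~ x) (gauss_term i.+2 n t x).
Proof.
move=> t1; have s0 : 0 < tau n + 1 + t by have := tau_ge2 n; lra.
have ds : is_derive t (1 : R) (fun y => tau n + 1 + y) 1.
  have : is_derive t (1 : R) (cst (tau n + 1) + id) 1.
    by apply: is_derive_eq; rewrite add0r.
  exact.
have dh := is_derive_heat_deriv_s i (x - 4 * tau n) s0.
have dc := @is_derive1_comp _ (heat_deriv i ^~ (x - 4 * tau n)) (fun y => tau n + 1 + y) _ _ _ dh ds; rewrite mulr1 in dc.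
exact: is_deriveZ.
Qed.

Lemma is_derive_gauss_sum_x i (t x : R) : -1 < t ->
  is_derive x (1 : R) (gauss_sum i t) (gauss_sum i.+1 t x).
Proof.
move=> t1; pose X := `|x| + 1.
have Ix : `]x - 1, x + 1[%classic x by rewrite /= in_itv/=; apply/andP; split; lra.
have IX y : `]x - 1, x + 1[%classic y -> `|y| <= X.
  rewrite /= in_itv/= => /andP[y1 y2]; rewrite /X.
  have : `|y - x| <= 1 by apply/ler_normlP; split; lra.
  by have := lerB_dist y x; lra.
have intf y : `]x - 1, x + 1[%classic y ->
    count.-integrable [set: nat] (EFin \o (fun n => gauss_term i n t y)).
  by move=> _; exact: integrable_gauss_term.
have derf y n : `]x - 1, x + 1[%classic y -> [set: nat] n ->
    derivable (fun y => gauss_term i n t y) y 1.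
  by move=> _ _; exact: (@ex_derive _ _ _ _ _ _ _ (is_derive_gauss_term_x i n y t1)).
have G0 n : 0 <= local_const i.+1 t X * expR (- n%:R) by rewrite mulr_ge0 ?expR_ge0.
have dE n y : partial1of2 (fun y n => gauss_term i n t y) y n = gauss_term i.+1 n t y.
  by rewrite partial1of2E (@derive_val _ _ _ _ _ _ _ (is_derive_gauss_term_x i n y t1)).
have Gub y n : `]x - 1, x + 1[%classic y -> [set: nat] n ->
    `|partial1of2 (fun y n => gauss_term i n t y) y n| <= local_const i.+1 t X * expR (- n%:R).
  by move=> /IX yX _; rewrite dE; apply: gauss_term_local' => //; rewrite t1 lexx.
have D1 := @derivable_under_integral R _ nat count _ _ (@measurableT _ nat) _ _ _ Ix
  intf derf _ G0 (integrable_local _) Gub.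
have D2 := @differentiation_under_integral R _ nat count _ _ (@measurableT _ nat) _ _ _ Ix
  intf derf _ G0 (integrable_local _) Gub.
apply: DeriveDef; first exact: D1.
by rewrite -derive1E D2; apply: eq_Rintegral => n _; rewrite dE.
Qed.

Lemma is_derive_gauss_sum_t i (t x : R) : -1 < t ->
  is_derive t (1 : R) (gauss_sum i ^~ x) (gauss_sum i.+2 t x).
Proof.
move=> t1.
have It : `](-1), t + 1[%classic t by rewrite /= in_itv/= t1 ltrDl ltr01.
have I1 r : `](-1), t + 1[%classic r -> -1 < r <= t + 1.
  by rewrite /= in_itv/= => /andP[-> /ltW ->].
have intf r : `](-1), t + 1[%classic r ->
    count.-integrable [set: nat] (EFin \o (fun n => gauss_term i n r x)).
  by move=> /I1 /andP[r1 _]; exact: integrable_gauss_term.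
have derf r n : `](-1), t + 1[%classic r -> [set: nat] n ->
    derivable (fun r => gauss_term i n r x) r 1.
  move=> /I1 /andP[r1 _] _.
  exact: (@ex_derive _ _ _ _ _ _ _ (is_derive_gauss_term_t i n x r1)).
have G0 n : 0 <= local_const i.+2 (t + 1) `|x| * expR (- n%:R) by rewrite mulr_ge0 ?expR_ge0.
have dE n r : -1 < r ->
    partial1of2 (fun r n => gauss_term i n r x) r n = gauss_term i.+2 n r x.
  by move=> r1; rewrite partial1of2E (@derive_val _ _ _ _ _ _ _ (is_derive_gauss_term_t i n x r1)).
have Gub r n : `](-1), t + 1[%classic r -> [set: nat] n ->
    `|partial1of2 (fun r n => gauss_term i n r x) r n| <=
    local_const i.+2 (t + 1) `|x| * expR (- n%:R).
  move=> /I1 rI _; rewrite dE; last by case/andP: rI.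
  exact: gauss_term_local'.
have D1 := @derivable_under_integral R _ nat count _ _ (@measurableT _ nat) _ _ _ It
  intf derf _ G0 (integrable_local _) Gub.
have D2 := @differentiation_under_integral R _ nat count _ _ (@measurableT _ nat) _ _ _ It
  intf derf _ G0 (integrable_local _) Gub.
apply: DeriveDef; first exact: D1.
by rewrite -derive1E D2; apply: eq_Rintegral => n _; rewrite dE.
Qed.

Lemma gauss_sum_ge0 (t x : R) : 0 <= gauss_sum 0 t x.
Proof. by apply: Rintegral_ge0 => n _; exact/ltW/gauss_term_gt0. Qed.

(** Bounding derivatives by the sum itself is what makes the Cole-Hopf quotients
    bounded on the whole line, although the sum is unbounded. *)
Lemma gauss_sum_global i : exists2 C : R, 0 <= C &
  forall t x, -1 < t -> `|gauss_sum i t x| <= C * (gauss_sum 0 t x + 1).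
Proof.
pose C := i`!%:R * expR (i%:R * (4 + i%:R)) : R.
have C0 : 0 <= C by rewrite mulr_ge0 ?expR_ge0.
exists (C * (1 + geom)) => [|t x t1]; first by rewrite mulr_ge0// addr_ge0.
have I0 := integrable_gauss_term 0 x t1.
have Ig := @integrable_geometric R.
have ID := integrableD measurableT I0 Ig.
apply: (@le_trans _ _ (C * (gauss_sum 0 t x + geom))); last first.
  rewrite -mulrA ler_wpM2l//; have := gauss_sum_ge0 t x; have := geom_ge0; nra.
rewrite /gauss_sum /geom -RintegralD// -RintegralZl//.
apply: Rintegral_counting_bound.
  exact: (integrableZl measurableT C ID).
move=> n; apply: le_trans (gauss_term_global i n x t1) _.
by apply: ler_wpM2l => //; rewrite lerD2l.
Qed.

End gaussian_sum.

(** * The Cole-Hopf solution *)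

Lemma lipschitz_of_derive_on (R : realType) (f : R -> R) (I : interval R) (M : R) :
  (forall z, z \in I -> exists2 d : R, is_derive z (1 : R) f d & `|d| <= M) ->
  forall x y, x \in I -> y \in I -> `|f x - f y| <= M * `|x - y|.
Proof.
move=> df x y; wlog xy : x y / y < x.
  move=> H xI yI; have [xy|yx|->] := ltgtP x y; last by rewrite !subrr normr0 mulr0.
    by rewrite distrC [`|x - y|]distrC; exact: H.
  exact: H.
move=> xI yI.
have sub z : z \in `[y, x] -> z \in I.
  by move=> zI; apply: (interval_is_interval yI xI); rewrite in_itv/= in zI.
have dfz z : z \in `[y, x] -> is_derive z (1 : R) f (derive1 f z).
  move=> /sub /df[d hd _]; rewrite derive1E.
  by apply: DeriveDef => //; exact: (@ex_derive _ _ _ _ _ _ _ hd).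
have cf : {within `[y, x], continuous f}.
  by apply: derivable_within_continuous => z /dfz h; exact: (@ex_derive _ _ _ _ _ _ _ h).
have [c cI ->] := MVT xy (fun z zI => dfz z (subset_itv_oo_cc zI)) cf.
have cI' := subset_itv_oo_cc cI.
have [d hd dM] := df _ (sub _ cI').
by rewrite normrM derive1E (@derive_val _ _ _ _ _ _ _ hd) ler_wpM2r.
Qed.

Lemma lipschitz_of_derive (R : realType) (f : R -> R) (M : R) :
  (forall z, exists2 d : R, is_derive z (1 : R) f d & `|d| <= M) ->
  forall x y, `|f x - f y| <= M * `|x - y|.
Proof.
by move=> df x y; apply: (@lipschitz_of_derive_on _ _ `]-oo, +oo[).
Qed.

Section cole_hopf.
Context (R : realType) (tau : nat -> R).
Hypothesis tau_ge : forall n, n%:R + 2 <= tau n.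

(** The i-th x-derivative of w = 1 + V (t,x) + V (t,-x): the leading bracket is that
    of the constant, and the sign comes from the reflection. *)
Definition theta (i : nat) (t x : R) : R :=
  (i == 0)%:R + (gauss_sum tau i t x + (-1) ^+ i * gauss_sum tau i t (- x)).

(** These quotients are closed under differentiation: the x-derivative of
    r_i is r_(i+1) - r_i r_1, and its t-derivative is r_(i+2) - r_i r_2.  All derivatives
    of u are therefore polynomials in them. *)
Definition theta_ratio (i : nat) (t x : R) : R := theta i t x / theta 0 t x.

Definition cole_hopf (t x : R) : R := - 2 * theta_ratio 1 t x.

Lemma theta_ge1 (t x : R) : 1 <= theta 0 t x.
Proof.
by rewrite /theta eqxx expr0 mul1r lerDl addr_ge0// gauss_sum_ge0.
Qed.

Let theta_neq0 (t x : R) : theta 0 t x != 0.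
Proof. by rewrite gt_eqF// (lt_le_trans _ (theta_ge1 t x)). Qed.

Lemma is_derive_theta_x i (t x : R) : -1 < t ->
  is_derive x (1 : R) (theta i t) (theta i.+1 t x).
Proof.
move=> t1; have d1 := is_derive_gauss_sum_x tau_ge i x t1.
have dN : is_derive x (1 : R) (fun y : R => - y) (-1).
  by apply: is_derive_eq.
have d2 := @is_derive1_comp _ (gauss_sum tau i t) (fun y => - y) _ _ _
  (is_derive_gauss_sum_x tau_ge i (- x) t1) dN.
rewrite /theta; apply: is_derive_eq; rewrite /GRing.scale/= exprS.
by ring.
Qed.

Lemma is_derive_theta_t i (t x : R) : -1 < t ->
  is_derive t (1 : R) (theta i ^~ x) (theta i.+2 t x).
Proof.
move=> t1; have d1 := is_derive_gauss_sum_t tau_ge i x t1.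
have d2 := is_derive_gauss_sum_t tau_ge i (- x) t1.
rewrite /theta; apply: is_derive_eq; rewrite /GRing.scale/= !exprS.
by ring.
Qed.

Lemma is_derive_ratio_x i (t x : R) : -1 < t ->
  is_derive x (1 : R) (theta_ratio i t)
    (theta_ratio i.+1 t x - theta_ratio i t x * theta_ratio 1 t x).
Proof.
move=> t1; have d1 := is_derive_theta_x i x t1.
have d0 := is_derive_theta_x 0 x t1.
rewrite /theta_ratio; apply: is_derive_eq; rewrite /GRing.scale/=.
by field; exact: theta_neq0.
Qed.

Lemma is_derive_ratio_t i (t x : R) : -1 < t ->
  is_derive t (1 : R) (theta_ratio i ^~ x)
    (theta_ratio i.+2 t x - theta_ratio i t x * theta_ratio 2 t x).
Proof.
move=> t1; have d1 := is_derive_theta_t i x t1.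
have d0 := is_derive_theta_t 0 x t1.
rewrite /theta_ratio; apply: is_derive_eq; rewrite /GRing.scale/=.
by field; exact: theta_neq0.
Qed.

Lemma theta_ratio_bounded i : exists2 M : R, 0 <= M &
  forall t x, -1 < t -> `|theta_ratio i t x| <= M.
Proof.
have [C C0 HC] := gauss_sum_global tau_ge i.
exists (1 + 2 * C) => [|t x t1]; first by lra.
have th := theta_ge1 t x; have th0 : 0 < theta 0 t x by lra.
rewrite /theta_ratio normf_div (gtr0_norm th0) ler_pdivrMr//.
have h1 := HC t x t1; have h2 := HC t (- x) t1.
have b1 : `|(i == 0)%:R| <= 1 :> R by case: eqP => _; rewrite ?normr1 ?normr0.
have b2 : `|(-1) ^+ i * gauss_sum tau i t (- x)| = `|gauss_sum tau i t (- x)|.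
  by rewrite normrM normrX normrN1 expr1n mul1r.
have g1 := gauss_sum_ge0 tau t x; have g2 := gauss_sum_ge0 tau t (- x).
have thE : theta 0 t x = 1 + (gauss_sum tau 0 t x + gauss_sum tau 0 t (- x)).
  by rewrite /theta eqxx expr0 mul1r.
have := ler_normD (i == 0)%:R (gauss_sum tau i t x + (-1) ^+ i * gauss_sum tau i t (- x)).
have := ler_normD (gauss_sum tau i t x) ((-1) ^+ i * gauss_sum tau i t (- x)).
rewrite b2 -/(theta i t x) thE; move: b1 h1 h2 g1 g2.
move: (gauss_sum tau 0 t x) (gauss_sum tau 0 t (- x)) => p q.
move: (`|_ + _ * _|) (`|theta i t x|) (`|_%:R|) (`|gauss_sum tau i t x|)
  (`|gauss_sum tau i t (- x)|) => a b c d e c1 dp eq p0 q0 h3 h4.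
by have := mulr_ge0 C0 p0; have := mulr_ge0 C0 q0; nra.
Qed.

Lemma ratio_joint_continuous i (t x : R) : -1 < t ->
  {for (t, x), continuous (fun q : R * R => theta_ratio i q.1 q.2)}.
Proof.
move=> t1.
have [M M0 HM] := theta_ratio_bounded i.+1; have [M1 M10 HM1] := theta_ratio_bounded 1.
have [N N0 HN] := theta_ratio_bounded i.
apply: (@lipschitz_joint_continuous _ _ _ _ (M + N * M1) (t + 1)).
- by lra.
- by rewrite addr_ge0// mulr_ge0.
- move=> s y /ltr_normlP[st _] _; have s1 : -1 < s by lra.
  apply: lipschitz_of_derive => z; exists (theta_ratio i.+1 s z - theta_ratio i s z * theta_ratio 1 s z).
    exact: is_derive_ratio_x.
  apply: le_trans (ler_normB _ _) _; apply: lerD; first exact: HM.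
  by rewrite normrM; apply: ler_pM => //; [exact: HN|exact: HM1].
- exact: (is_derive_continuous (is_derive_ratio_t i x t1)).
Qed.

Lemma cole_hopf_derive_x (t x : R) : -1 < t ->
  is_derive x (1 : R) (cole_hopf t) (-2 * (theta_ratio 2 t x - theta_ratio 1 t x ^+ 2)).
Proof.
move=> t1; have d := is_derive_ratio_x 1 x t1.
by rewrite /cole_hopf; apply: is_derive_eq; rewrite /GRing.scale/=; ring.
Qed.

Lemma cole_hopf_derive_t (t x : R) : -1 < t ->
  is_derive t (1 : R) (cole_hopf ^~ x)
    (-2 * (theta_ratio 3 t x - theta_ratio 1 t x * theta_ratio 2 t x)).
Proof.
move=> t1; have d := is_derive_ratio_t 1 x t1.
by rewrite /cole_hopf; apply: is_derive_eq; rewrite /GRing.scale/=; ring.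
Qed.

Lemma cole_hopf_derive1_x (t : R) : -1 < t -> derive1 (cole_hopf t) =
  (fun x => -2 * (theta_ratio 2 t x - theta_ratio 1 t x ^+ 2)).
Proof.
move=> t1; apply/funext => x; rewrite derive1E.
exact: (@derive_val _ _ _ _ _ _ _ (cole_hopf_derive_x x t1)).
Qed.

Lemma cole_hopf_derive1_t (t x : R) : -1 < t -> derive1 (cole_hopf ^~ x) t =
  -2 * (theta_ratio 3 t x - theta_ratio 1 t x * theta_ratio 2 t x).
Proof.
move=> t1; rewrite derive1E.
exact: (@derive_val _ _ _ _ _ _ _ (cole_hopf_derive_t x t1)).
Qed.

Lemma cole_hopf_derive_xx (t x : R) : -1 < t ->
  is_derive x (1 : R) (derive1 (cole_hopf t))
    (-2 * (theta_ratio 3 t x - 3 * (theta_ratio 1 t x * theta_ratio 2 t x)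
           + 2 * theta_ratio 1 t x ^+ 3)).
Proof.
move=> t1; have d1 := is_derive_ratio_x 1 x t1; have d2 := is_derive_ratio_x 2 x t1.
rewrite cole_hopf_derive1_x//.
by apply: is_derive_eq; rewrite /GRing.scale/=; ring.
Qed.

Lemma cole_hopf_bounded : exists2 M : R, 0 <= M &
  forall t x, -1 < t -> `|cole_hopf t x| <= M.
Proof.
have [M M0 HM] := theta_ratio_bounded 1.
exists (2 * M) => [|t x t1]; first by rewrite mulr_ge0.
by rewrite /cole_hopf normrM normrN (ger0_norm (ler0n _ 2)) ler_wpM2l// HM.
Qed.

Lemma cole_hopf_lipschitz_t : exists2 L : R, 0 <= L &
  forall s t x, -1 < s -> -1 < t -> `|cole_hopf s x - cole_hopf t x| <= L * `|s - t|.
Proof.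
have [M1 M10 HM1] := theta_ratio_bounded 1; have [M2 M20 HM2] := theta_ratio_bounded 2.
have [M3 M30 HM3] := theta_ratio_bounded 3.
exists (2 * (M3 + M1 * M2)) => [|s t x s1 t1]; first by rewrite mulr_ge0// addr_ge0// mulr_ge0.
apply: (@lipschitz_of_derive_on _ (fun r => cole_hopf r x) `](-1), +oo[).
- move=> r; rewrite in_itv/= andbT => r1.
  exists (-2 * (theta_ratio 3 r x - theta_ratio 1 r x * theta_ratio 2 r x)).
    exact: cole_hopf_derive_t.
  rewrite normrM normrN (ger0_norm (ler0n _ 2)) ler_wpM2l//.
  apply: le_trans (ler_normB _ _) _; apply: lerD; first exact: HM3.
  by rewrite normrM; apply: ler_pM => //; [exact: HM1|exact: HM2].
- by rewrite in_itv/= s1.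
- by rewrite in_itv/= t1.
Qed.

Lemma cole_hopf_continuous (t : R) : -1 < t -> continuous (cole_hopf t).
Proof.
move=> t1 x; exact: (is_derive_continuous (cole_hopf_derive_x x t1)).
Qed.

(** The explicit solution exists for t > -1, with bounds that do not degenerate
    at t = 0, so the initial datum is attained by dominated convergence. *)
Lemma cole_hopf_solution : burgers_solution (cole_hopf 0) cole_hopf.
Proof.
have pos (t : R) : 0 < t -> -1 < t by move=> t0; lra.
have [M M0 HM] := cole_hopf_bounded.
split.
- by move=> t x /pos t1; exact: (@ex_derive _ _ _ _ _ _ _ (cole_hopf_derive_t x t1)).
- by move=> t x /pos t1; exact: (@ex_derive _ _ _ _ _ _ _ (cole_hopf_derive_x x t1)).
- by move=> t x /pos t1; exact: (@ex_derive _ _ _ _ _ _ _ (cole_hopf_derive_xx x t1)).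
- move=> [t x] /= t0; have t1 := pos _ t0.
  have c1 := @ratio_joint_continuous 1 t x t1.
  have c2 := @ratio_joint_continuous 2 t x t1.
  have c3 := @ratio_joint_continuous 3 t x t1.
  (* Derivatives are identified for times above -1 only; continuity is a local
     property and passes along the equality there. *)
  have near_t (f g : R * R -> R) : (forall q, -1 < q.1 -> f q = g q) ->
      {for (t, x), continuous g} -> {for (t, x), continuous f}.
    move=> fg cg.
    have nfg : \forall q \near nbhs (t, x), f q = g q.
      exists ([set s : R | -1 < s], setT) => /=.
        by split; [exact: lt_nbhsr|exact: filterT].
      by move=> [s y] /= [s1 _]; exact: fg.
    rewrite /prop_for /continuous_at (fg (t, x))//.
    apply: cvg_trans cg; apply: near_eq_cvg.
    by apply: filterS nfg => q ->.
  have k2 (g : R * R -> R) : {for (t, x), continuous g} ->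
      {for (t, x), continuous (fun q => -2 * g q)}.
    by move=> cg; apply: continuousM => //; exact: cst_continuous.
  split.
  + exact: (k2 _ c1).
  + apply: near_t (k2 _ (continuousB c3 (continuousM c1 c2))) => q q1.
    by rewrite cole_hopf_derive1_t.
  + apply: near_t (k2 _ (continuousB c2 (continuousM c1 c1))) => q q1.
    by rewrite cole_hopf_derive1_x// expr2.
  + apply: (near_t _ (fun q : R * R => -2 * (theta_ratio 3 q.1 q.2 -
        3 * (theta_ratio 1 q.1 q.2 * theta_ratio 2 q.1 q.2) +
        2 * (theta_ratio 1 q.1 q.2 * (theta_ratio 1 q.1 q.2 * theta_ratio 1 q.1 q.2))))) => [q q1|].
      rewrite derive1E (@derive_val _ _ _ _ _ _ _ (cole_hopf_derive_xx q.2 q1)).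
      by rewrite !exprS expr0 mulr1.
    have c0 (k : R) : {for (t, x), continuous (fun q : R * R => k)} by exact: cst_continuous.
    apply: k2; apply: continuousD.
      exact: (continuousB c3 (continuousM (c0 3) (continuousM c1 c2))).
    exact: (continuousM (c0 2) (continuousM c1 (continuousM c1 c1))).
- move=> t x /pos t1; rewrite cole_hopf_derive1_t// cole_hopf_derive1_x//.
  have := @derive_val _ _ _ _ _ _ _ (cole_hopf_derive_xx x t1).
  rewrite cole_hopf_derive1_x// derive1E => ->.
  by rewrite /cole_hopf; ring.
- move=> t /pos t1; apply: (@bounded_Linfty _ _ M); first exact: cole_hopf_continuous.
  by move=> x; exact: HM.
- move=> t t0; have [L L0 HL] := cole_hopf_lipschitz_t.
  have t1 := pos _ t0.
  apply: (@squeeze_cvge _ _ _ _ (cst 0%E) _ (fun s : R => (L * `|s - t|)%:E)).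
  + near=> s; have s1 : -1 < s by near: s; exact: lt_nbhsr.
    rewrite Lnorm_ge0/=; apply/(@Lnorm_oo_leP _ (fun x => cole_hopf s x - cole_hopf t x)).
    by apply: aeW => x; exact: HL.
  + exact: cvg_cst.
  + apply: cvg_EFin; first exact: nearW.
    apply/cvgrPdist_le => e e0; apply/nbhs_ballP.
    have eL : 0 < e / (L + 1) by rewrite divr_gt0//; lra.
    exists (e / (L + 1)) => // s; rewrite /ball/= ltr_pdivlMr; last by lra.
    move=> h; rewrite sub0r normrN ger0_norm; last by rewrite mulr_ge0.
    by rewrite distrC; have := normr_ge0 (t - s); nra.
- move=> g ig; apply: cvg_at_right_filter.
  have I0 : (0 : R) \in `](-1), 1[ by rewrite in_itv/= ltrN10 ltr01.
  have I1 (s : R) : `](-1), 1[%classic s -> -1 < s by rewrite /= in_itv/= => /andP[].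
  have iM : (@lebesgue_measure R).-integrable [set: R] (EFin \o (fun x => M * `|g x|)).
    exact: (integrableZl measurableT M (integrable_norm ig)).
  have bd (s : R) : `](-1), 1[%classic s -> {ae @lebesgue_measure R,
      forall x, [set: R] x -> `|cole_hopf s x * g x| <= M * `|g x|}.
    by move=> /I1 s1; apply: aeW => x _; rewrite normrM ler_wpM2r// HM.
  have iF (s : R) : `](-1), 1[%classic s ->
      (@lebesgue_measure R).-integrable [set: R] (EFin \o (fun x => cole_hopf s x * g x)).
    move=> sI; apply: (integrableMr measurableT _ _ ig).
      by apply: continuous_measurable_fun; apply: cole_hopf_continuous; exact: I1.
    exists M; split; first exact: num_real.
    by move=> N MN y _ /=; apply: le_trans (ltW MN); apply: HM; exact: I1.
  have cf : {ae @lebesgue_measure R, forall x, [set: R] x ->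
      {in `](-1), 1[%classic, continuous (fun s => cole_hopf s x * g x)}}.
    apply: aeW => x _ s /set_mem sI.
    have k : {for s, continuous (fun s => cole_hopf s x)}.
      exact: (is_derive_continuous (cole_hopf_derive_t x (I1 _ sI))).
    exact: (cvgM k (cvg_cst (g x))).
  apply: (@continuity_under_integral R _ (measurableTypeR R) (@lebesgue_measure R)
    (fun s x => cole_hopf s x * g x) setT measurableT (-1) 1 iF cf _ iM bd).
  by rewrite inE.
Unshelve. all: by end_near. Qed.
End cole_hopf.

(** * Time windows *)

Section counting_split.
Context (R : realType).
Notation count := (@counting nat R).

Lemma counting_set1 N : count [set N] = 1%E.
Proof.
rewrite /counting asboolT; last exact: finite_set1.
by rewrite fset_set1 finmap.cardfs1.
Qed.

Lemma Rintegral_counting_split (f : nat -> R) N : count.-integrable [set: nat] (EFin \o f) ->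
  \int[count]_n f n = f N + \int[count]_n (if n == N then 0 else f n).
Proof.
move=> If.
have I1 : count.-integrable [set: nat] (EFin \o \1_[set N]).
  have Ig := integrableZl measurableT (expR N%:R) (@integrable_geometric R).
  apply: (le_integrable_counting Ig) => n; rewrite indicE.
  case: (eqVneq n N) => [->|nN]; last by rewrite memNset ?normr0 ?mulr_ge0 ?expR_ge0//; exact/eqP.
  by rewrite mem_set// normr1 -expRD subrr expR0.
have IN : count.-integrable [set: nat] (EFin \o (fun n => f N * \1_[set N] n)).
  exact: (integrableZl measurableT (f N) I1).
have Ir : count.-integrable [set: nat] (EFin \o (fun n => if n == N then 0 else f n)).
  apply: (le_integrable_counting (integrable_norm If)) => n.
  by case: ifP => _; rewrite ?normr0 ?normr_ge0.
have -> : f N = \int[count]_n (f N * \1_[set N] n).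
  rewrite RintegralZl// /Rintegral integral_indic// setIT.
  by rewrite [X in fine X](counting_set1 N) /= mulr1.
rewrite -RintegralD//; apply: eq_Rintegral => n _.
rewrite indicE; case: eqP => [->|nN]; first by rewrite mem_set// mulr1 addr0.
by rewrite memNset// mulr0 add0r.
Qed.
End counting_split.

Section tower.
Context (R : realType).

(** Inside the window of tau_(n+1), the spreading factor 1 / sqrt tau_(n+1) =
    exp (- 4 tau_n) has to beat the amplitude exp (2 tau_n) of the previous pair;
    this is what the constant 8 is for. *)
Fixpoint tower (n : nat) : R := if n is m.+1 then expR (8 * tower m) else 2.

Lemma expR_ge_sqr (x : R) : 0 <= x -> x ^+ 2 / 4 <= expR x.
Proof.
move=> x0; have e : expR x = expR (x / 2) ^+ 2.
  by rewrite expr2 -expRD; congr expR; field.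
rewrite e; have h := expR_ge1Dx (x / 2); move: (expR _) h => y h; nra.
Qed.

Lemma tower_ge n : n%:R + 2 <= tower n.
Proof.
elim: n => [|n IH]; first by rewrite add0r.
rewrite -[n.+1%:R]natr1 /=; have := expR_ge1Dx (8 * tower n).
have : 0 <= n%:R :> R by []; lra.
Qed.

Lemma tower_ge2 n : 2 <= tower n.
Proof. by apply: le_trans (tower_ge n); rewrite lerDr. Qed.

Lemma tower_sqr n : 16 * tower n ^+ 2 <= tower n.+1.
Proof.
have := @expR_ge_sqr (8 * tower n); have := tower_ge2 n.
by rewrite [tower n.+1]/=; move=> h1 /(_ ltac:(lra)); lra.
Qed.

Lemma tower_nondecreasing : {homo tower : m n / (m <= n)%N >-> m <= n}.
Proof.
apply: homo_leq => [//|x y z|n]; first exact: le_trans.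
have := tower_sqr n; have := tower_ge2 n; nra.
Qed.
End tower.

Section window.
Context (R : realType).
Notation tau := (@tower R).
Notation count := (@counting nat R).

(** The time t at which the width parameter tau_n + 1 + t equals 2 tau_n / k. *)
Definition window_time (n : nat) (k : R) : R := 2 * tau n / k - 1 - tau n.

Variables (n : nat) (k : R).
Hypothesis k0 : 0 < k.
Hypothesis k32 : k <= 3 / 2.
Hypothesis kV : k^-1 <= tau n.+1.

Let N := n.+1.
Let t := window_time N k.

Let t1E : t + 1 = 2 * tau N / k - tau N.
Proof. by rewrite /t /window_time; ring. Qed.

Lemma window_time_ge : tau N / 3 <= t + 1.
Proof.
have T2 := tower_ge2 R N.
rewrite t1E.
move: (tau N) T2 => T T2.
have k32r := k32; have k0r := k0.
have Tk : 0 <= T * (3 / 2 - k) by apply: mulr_ge0; [lra|rewrite subr_ge0].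
have : 4 / 3 * T <= 2 * T / k by rewrite ler_pdivlMr//; lra.
lra.
Qed.

Let t_up : t + 1 <= 2 * tau N ^+ 2.
Proof.
have T2 := tower_ge2 R N.
rewrite t1E; have := kV; rewrite -/N.
move: (tau N) T2 => T T2 h.
have : 2 * T / k <= 2 * T * T by rewrite ler_wpM2l// mulr_ge0//; lra.
nra.
Qed.

Lemma window_time_gt : -1 < t.
Proof. by have T2 := tower_ge2 R N; have := window_time_ge; lra. Qed.

(** Since the time is at most of order tau_(n+1)^2, far below tau_j, the j-th
    Gaussian has hardly spread and still contributes about exp (- 2 tau_j). *)
Lemma later_term i j x X : (N < j)%N -> `|x| <= X ->
  `|gauss_term tau i j t x| <=
  i`!%:R * expR (i%:R * (X + 2) + 2 * X) * (expR (- (tau n / 2)) * expR (- j%:R)).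
Proof.
move=> Nj xX.
have tI : -1 < t <= t by rewrite window_time_gt lexx.
apply: le_trans (gauss_term_local (@tower_ge R) i j tI xX) _.
rewrite -!mulrA ler_wpM2l// -!expRD ler_expR.
have T2 := tower_ge2 R N.
have := t_up; have := tower_sqr R N; have := tower_nondecreasing R Nj.
have := tower_ge R j; have := tower_nondecreasing R (leqnSn n); rewrite -/N.
by move=> h1 h2 h3 h4 h5; nra.
Qed.

(** The elapsed time is at least of order tau_(n+1) = exp (8 tau_n), so the j-th
    Gaussian is bounded by exp (2 tau_j) sqrt tau_j times exp (- 4 tau_n), up to a constant. *)
Lemma earlier_term i j x X : (j < N)%N -> `|x| <= X ->
  `|gauss_term tau i j t x| <=
  i`!%:R * expR (i%:R * (X + 2) + 2 * X + 1) * (expR (- (tau n / 2)) * expR (- j%:R)).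
Proof.
move=> jN xX; have t1 := window_time_gt; have T2 := tower_ge2 R j.
have X0 : 0 <= X by apply: le_trans xX.
apply: le_trans (gauss_term_bound (@tower_ge R) i j x t1) _.
rewrite -!mulrA ler_wpM2l//.
apply: (@le_trans _ _ (expR (i%:R * (X + 2)) * expR (1 - tau n / 2 - j%:R))); last first.
  by rewrite -!expRD ler_expR; lra.
apply: ler_pM; [exact: expR_ge0|exact/ltW/gauss_term_gt0| |].
  by rewrite ler_expR ler_wpM2l//; exact: slope_bound.
rewrite /gauss_term heat_deriv0.
have s0 : 0 < tau j + 1 + t by lra.
apply: le_trans (ler_wpM2l (expR_ge0 _) (heat_le _ s0)) _.
rewrite -expRD ler_expR.
have lnj : ln (tau j) <= tau j by have := @le_ln1Dx _ (tau j - 1); rewrite [1 + _]addrC subrK => /(_ ltac:(lra)); lra.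
have lns : 8 * tau n - 2 <= ln (tau j + 1 + t).
  have -> : 8 * tau n - 2 = ln (expR (8 * tau n - 2)) by rewrite expRK.
  rewrite ler_ln ?posrE ?expR_gt0//.
  rewrite expRD; apply: (@le_trans _ _ (tau N / 3)); last by have := window_time_ge; lra.
  rewrite ler_wpM2l ?expR_ge0// expRN lef_pV2 ?posrE ?expR_gt0//.
  by have := expR_ge1Dx (2 : R); lra.
have : j%:R + 2 <= tau n.
  by apply: le_trans (tower_ge R j) (tower_nondecreasing R _).
have := tower_nondecreasing R (jN : (j <= n)%N).
have := tower_ge R j.
move=> h1 h2 h3; lra.
Qed.

Lemma rest_bound i x X : `|x| <= X ->
  `|gauss_sum tau i t x - gauss_term tau i N t x| <=
  i`!%:R * expR (i%:R * (X + 2) + 2 * X + 1) * expR (- (tau n / 2)) *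
  \int[count]_j expR (- j%:R).
Proof.
move=> xX; have t1 := window_time_gt.
have If := integrable_gauss_term (@tower_ge R) i x t1.
rewrite /gauss_sum (Rintegral_counting_split N If) addrC addKr.
rewrite -RintegralZl//; last exact: integrable_geometric.
set C := _ * expR (- (tau n / 2)).
have C0 : 0 <= C by rewrite !mulr_ge0 ?expR_ge0.
apply: Rintegral_counting_bound.
  exact: (integrableZl measurableT C (@integrable_geometric R)).
move=> j; case: eqVneq => [_|]; first by rewrite normr0 mulr_ge0// expR_ge0.
rewrite neq_ltn => /orP[jN|Nj].
  by apply: le_trans (earlier_term i jN xX) _; rewrite /C mulrA.
apply: le_trans (later_term i Nj xX) _; rewrite /C mulrA.
rewrite !ler_wpM2r ?expR_ge0// ler_wpM2l// ler_expR; lra.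
Qed.

Let sig := k / (8 * tau N).
Let A := expR (2 * tau N * (1 - k) + ln (k / 2) / 2).

Let tN0 : 0 < tau N. Proof. by have := tower_ge2 R N; lra. Qed.

Let sE : tau N + 1 + t = 2 * tau N / k.
Proof. by rewrite /t /window_time; ring. Qed.

(** Completing the square: with s = 2 T / k one has
    (x - 4 T)^2 / (4 s) = k x^2 / (8 T) - k x + 2 T k. *)
Lemma main_term0 x : gauss_term tau 0 N t x = A * expR (k * x - sig * x ^+ 2).
Proof.
rewrite /gauss_term heat_deriv0 /heat sE -!expRD; congr expR.
have -> : ln (2 * tau N / k) = ln (tau N) - ln (k / 2).
  rewrite -ln_div ?posrE ?divr_gt0//; congr ln; field; exact: lt0r_neq0.
rewrite /sig; field; apply/andP; split; exact: lt0r_neq0.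
Qed.

Lemma main_term1 x :
  gauss_term tau 1 N t x = (k - 2 * sig * x) * (A * expR (k * x - sig * x ^+ 2)).
Proof.
rewrite -main_term0 /gauss_term heat_deriv0 heat_deriv1 sE.
by rewrite /sig; field; apply/andP; split; exact: lt0r_neq0.
Qed.

Definition tail_const (X : R) : R :=
  2 * (expR (X + 2 + 2 * X + 1) * \int[count]_j expR (- j%:R)).

Let rest01 i x X : (i <= 1)%N -> `|x| <= X ->
  `|gauss_sum tau i t x - gauss_term tau i N t x| <= tail_const X / 2 * expR (- (tau n / 2)).
Proof.
move=> i1 xX; have X0 : 0 <= X by apply: le_trans xX.
apply: le_trans (rest_bound i xX) _; rewrite /tail_const.
have g0 : 0 <= \int[count]_j expR (- j%:R : R).
  by apply: Rintegral_ge0 => j _; exact: expR_ge0.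
rewrite [2 * (_ * _)]mulrC mulfK// [leRHS]mulrAC; apply: ler_wpM2r => //.
apply: ler_wpM2r; first exact: expR_ge0.
have -> : i`!%:R = 1 :> R by case: i i1 => [|[|]].
rewrite mul1r ler_expR; case: i i1 => [|[|]]// _; lra.
Qed.

(** The number 1 / (2 A): dividing w by 2 A turns the active pair into
    cosh (k x) and the background constant 1 into this weight. *)
Definition window_weight : R := expR (- (2 * tau N * (1 - k) + ln (k / 2) / 2)) / 2.

Lemma window_ratio X x : `|x| <= X ->
  exists r0 r1 : R,
  [/\ `|r0| <= window_weight * tail_const X * expR (- (tau n / 2)),
      `|r1| <= window_weight * tail_const X * expR (- (tau n / 2)) &
      theta_ratio tau 1 t x =
      (((k - 2 * sig * x) * expR (k * x - sig * x ^+ 2) -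
        (k + 2 * sig * x) * expR (- (k * x) - sig * x ^+ 2)) / 2 + r1) /
      (window_weight + (expR (k * x - sig * x ^+ 2) + expR (- (k * x) - sig * x ^+ 2)) / 2 + r0)].
Proof.
move=> xX; have xX' : `|- x| <= X by rewrite normrN.
have w0 : 0 < window_weight by rewrite divr_gt0 ?expR_gt0.
have wA : window_weight * A = 1 / 2.
  by rewrite /window_weight /A mulrAC -expRD addNr expR0.
pose e i y := gauss_sum tau i t y - gauss_term tau i N t y.
exists (window_weight * (e 0%N x + e 0%N (- x))), (window_weight * (e 1%N x - e 1%N (- x))).
split.
- rewrite normrM (gtr0_norm w0) -mulrA ler_wpM2l//; first exact: ltW.
  apply: le_trans (ler_normD _ _) _.
  have := rest01 (leq0n 1) xX; have := rest01 (leq0n 1) xX'; rewrite -/(e _ _) -/(e _ _).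
  lra.
- rewrite normrM (gtr0_norm w0) -mulrA ler_wpM2l//; first exact: ltW.
  apply: le_trans (ler_normB _ _) _.
  have := rest01 (leqnn 1) xX; have := rest01 (leqnn 1) xX'; rewrite -/(e _ _) -/(e _ _).
  lra.
have th0 := theta_ge1 tau t x.
have ge i y : gauss_sum tau i t y = gauss_term tau i N t y + e i y by rewrite /e addrC subrK.
have h E : window_weight * (A * E) = E / 2 by rewrite mulrA wA; field.
have -> : theta_ratio tau 1 t x =
    (window_weight * theta tau 1 t x) / (window_weight * theta tau 0 t x).
  rewrite /theta_ratio; field; rewrite (gt_eqF w0)/= gt_eqF//; lra.
rewrite /theta !ge !main_term0 !main_term1 mulrN sqrrN mulrN opprK.
move: (expR (k * x - _)) (expR (- (k * x) - _)) (e _ _) (e _ _) (e _ _) (e _ _) => E F a b c d.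
rewrite eqxx expr0 expr1 mul1r mulN1r [(1 == 0)%N]/= add0r.
move: (window_weight) (A) h => w A' h.
congr (_ / _).
  by have h1 := h ((k - 2 * sig * x) * E); have h2 := h ((k + 2 * sig * x) * F); lra.
rewrite -[true%:R]/(1 : R); have h1 := h E; have h2 := h F; lra.
Qed.
End window.

(** * Convergence to the limiting profiles *)

(** The Cole-Hopf transform of p + cosh (k x). *)
Definition profile (R : realType) (k p x : R) : R :=
  - 2 * (k * sinh (k * x)) / (p + cosh (k * x)).

Lemma expR_diff_le (R : realType) (a b M : R) : a <= M -> b <= M ->
  `|expR a - expR b| <= `|a - b| * expR M.
Proof.
wlog ab : a b / b <= a.
  move=> H aM bM; have [|/ltW] := leP b a; first by move=> /H; apply.
  by rewrite distrC [`|a - b|]distrC => /H; apply.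
move=> aM _; rewrite !ger0_norm ?subr_ge0// ?ler_expR//.
have h := expR_ge1Dx (b - a); have ea := expR_gt0 a.
have eb : expR b = expR a * expR (b - a) by rewrite -expRD; congr expR; ring.
have eM : expR a <= expR M by rewrite ler_expR.
apply: (@le_trans _ _ ((a - b) * expR a)); last by rewrite ler_wpM2l// subr_ge0.
by rewrite eb; move: (expR a) (expR (b - a)) h ea => y z; nra.
Qed.

(** The splitting num/den - N/D = (num - N)/den - (N/D) (den - D)/den only needs a
    lower bound of the denominators. *)
Lemma ratio_diff_le (R : realType) (num den N D d M : R) :
  1 <= D -> `|den - D| <= d -> `|num - N| <= d -> `|N| <= M -> d <= 1 / 2 ->
  `|num / den - N / D| <= 2 * (1 + M) * d.
Proof.
move=> D1 dden dnum NM d2.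
have den2 : 1 / 2 <= den by move/ler_normlP : dden => [d3 d4]; lra.
have -> : num / den - N / D = (num - N) / den - N / D * ((den - D) / den).
  by field; rewrite !gt_eqF//; lra.
have denV : `|den^-1| <= 2.
  rewrite ger0_norm ?invr_ge0; last by lra.
  by rewrite -[leLHS]mul1r ler_pdivrMr; lra.
have ND : `|N / D| <= M.
  rewrite normrM [`|D^-1|]ger0_norm ?invr_ge0; last by lra.
  rewrite ler_pdivrMr; last by lra.
  by apply: (le_trans NM); rewrite ler_peMr// (le_trans _ NM).
have s1 : `|(num - N) / den| <= d * 2 by rewrite normrM; apply: ler_pM.
have s2 : `|N / D * ((den - D) / den)| <= M * (d * 2).
  by rewrite normrM; apply: ler_pM => //; rewrite normrM; apply: ler_pM.
apply: le_trans (ler_normB _ _) _; apply: le_trans (lerD s1 s2) _; lra.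
Qed.

Lemma profile_estimate (R : realType) (k k' p p' sig X x r0 r1 eta : R) :
  let Q := expR (2 * X + X ^+ 2) in
  let B := 2 + (2 * (X + X ^+ 2) + 1 + 2 * X) * Q in
  let E := expR (k * x - sig * x ^+ 2) in
  let F := expR (- (k * x) - sig * x ^+ 2) in
  0 <= k <= 2 -> 0 <= k' <= 2 -> 0 <= sig <= eta -> 0 <= p' -> `|x| <= X ->
  `|k - k'| <= eta -> `|p - p'| <= eta -> `|r0| <= eta -> `|r1| <= eta ->
  eta * B <= 1 / 2 ->
  `|- 2 * ((((k - 2 * sig * x) * E - (k + 2 * sig * x) * F) / 2 + r1) /
     (p + (E + F) / 2 + r0)) - profile k' p' x| <= 4 * (1 + 2 * Q) * B * eta.
Proof.
move=> Q B E F /andP[k0 k2] /andP[k'0 k'2] /andP[sig0 sige] p'0 xX kk pp hr0 hr1 etaB.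
have X0 : 0 <= X by apply: le_trans xX.
have eta0 : 0 <= eta by apply: le_trans hr0.
have Q1 : 1 <= Q.
  by rewrite /Q -[leLHS]expR0 ler_expR addr_ge0 ?sqr_ge0// mulr_ge0.
have x2 : x ^+ 2 <= X ^+ 2 by rewrite -[x ^+ 2]real_normK ?num_real// lerXn2r ?nnegrE.
have x20 := sqr_ge0 x.
pose E' := expR (k' * x); pose F' := expR (- (k' * x)).
have kx (c : R) : 0 <= c <= 2 -> `|c * x| <= 2 * X.
  move=> /andP[c0 c2]; rewrite normrM (ger0_norm c0); apply: ler_pM => //.
have {}kx c : 0 <= c <= 2 -> c * x <= 2 * X /\ - (c * x) <= 2 * X.
  by move=> /kx /ler_normlP[].
have [kx1 kx2] := kx k ltac:(by rewrite k0).
have [kx1' kx2'] := kx k' ltac:(by rewrite k'0).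
have sx0 : 0 <= sig * x ^+ 2 by rewrite mulr_ge0.
have X20 : 0 <= X ^+ 2 by exact: sqr_ge0.
have EQ : E <= Q by rewrite ler_expR; lra.
have FQ : F <= Q by rewrite ler_expR; lra.
have EQ' : E' <= Q by rewrite ler_expR; lra.
have FQ' : F' <= Q by rewrite ler_expR; lra.
have E0 : 0 < E by exact: expR_gt0.
have F0 : 0 < F by exact: expR_gt0.
have E'0 : 0 < E' by exact: expR_gt0.
have F'0 : 0 < F' by exact: expR_gt0.
have kkx : `|(k - k') * x| <= eta * X by rewrite normrM; apply: ler_pM.
have sx : sig * x ^+ 2 <= eta * X ^+ 2 by apply: ler_pM.
have dE : `|E - E'| <= eta * (X + X ^+ 2) * Q.
  apply: le_trans (expR_diff_le (M := 2 * X + X ^+ 2) _ _) _; [lra|lra|].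
  rewrite ler_wpM2r ?expR_ge0//.
  have -> : k * x - sig * x ^+ 2 - k' * x = (k - k') * x - sig * x ^+ 2 by ring.
  apply: le_trans (ler_normB _ _) _; rewrite (ger0_norm sx0); lra.
have dF : `|F - F'| <= eta * (X + X ^+ 2) * Q.
  apply: le_trans (expR_diff_le (M := 2 * X + X ^+ 2) _ _) _; [lra|lra|].
  rewrite ler_wpM2r ?expR_ge0//.
  have -> : - (k * x) - sig * x ^+ 2 - - (k' * x) = - ((k - k') * x) - sig * x ^+ 2 by ring.
  apply: le_trans (ler_normB _ _) _; rewrite normrN (ger0_norm sx0); lra.
pose N := k' * (E' - F') / 2; pose D := p' + (E' + F') / 2.
set num := _ / 2 + r1; set den := p + _ + r0.
have profE : profile k' p' x = - 2 * (N / D).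
  by rewrite /profile /N /D /sinh /cosh -/E' -/F' !mulrA.
have EF' : 2 <= E' + F'.
  have EF1 : E' * F' = 1 by rewrite /E' /F' -expRD subrr expR0.
  by have := sqr_ge0 (E' - F'); nra.
have D1 : 1 <= D by rewrite /D; lra.
pose W := eta * (X + X ^+ 2) * Q.
have W0 : 0 <= W by rewrite !mulr_ge0 ?addr_ge0// (le_trans _ Q1).
have eQ : 0 <= eta * Q by rewrite mulr_ge0// (le_trans _ Q1).
have eXQ : 0 <= eta * X * Q by rewrite !mulr_ge0// (le_trans _ Q1).
have etaBE : eta * B = 2 * eta + 2 * W + eta * Q + 2 * (eta * X * Q).
  by rewrite /B /W; ring.
move/ler_normlP : dE => [dE1 dE2]; move/ler_normlP : dF => [dF1 dF2].
have dden : `|den - D| <= eta * B.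
  move/ler_normlP : pp => [pp1 pp2]; move/ler_normlP : hr0 => [hr01 hr02].
  rewrite etaBE /den /D; apply/ler_normlP.
  rewrite -/W in dE1 dE2 dF1 dF2; clear -dE1 dE2 dF1 dF2 pp1 pp2 hr01 hr02 eQ eXQ W0.
  by clearbody W E F E' F' Q; split; lra.
have dnum : `|num - N| <= eta * B.
  have -> : num - N = (k * (E - E') + (k - k') * E' - k * (F - F') - (k - k') * F'
      - 2 * (sig * x) * (E + F)) / 2 + r1 by rewrite /num /N; field.
  have b1 : `|k * (E - E')| <= 2 * W.
    by rewrite normrM (ger0_norm k0); apply: ler_pM => //; apply/ler_normlP.
  have b2 : `|(k - k') * E'| <= eta * Q by rewrite normrM (gtr0_norm E'0); apply: ler_pM => //; exact: ltW.
  have b3 : `|k * (F - F')| <= 2 * W.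
    by rewrite normrM (ger0_norm k0); apply: ler_pM => //; apply/ler_normlP.
  have b4 : `|(k - k') * F'| <= eta * Q by rewrite normrM (gtr0_norm F'0); apply: ler_pM => //; exact: ltW.
  have b5 : `|2 * (sig * x) * (E + F)| <= 2 * (eta * X) * (2 * Q).
    rewrite normrM [`|E + F|]ger0_norm; last by rewrite addr_ge0// ltW.
    rewrite normrM (ger0_norm (ler0n _ 2)) normrM (ger0_norm sig0).
    apply: ler_pM; [by rewrite !mulr_ge0|by rewrite addr_ge0// ltW| |].
      by rewrite ler_wpM2l//; apply: ler_pM.
    by rewrite [2 * Q]mulrDl mul1r lerD.
  move/ler_normlP : b1 => [b11 b12]; move/ler_normlP : b2 => [b21 b22].
  move/ler_normlP : b3 => [b31 b32]; move/ler_normlP : b4 => [b41 b42].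
  move/ler_normlP : b5 => [b51 b52]; move/ler_normlP : hr1 => [hr11 hr12].
  rewrite etaBE; apply/ler_normlP.
  clear -b11 b12 b21 b22 b31 b32 b41 b42 b51 b52 hr11 hr12 eQ eXQ W0 eta0.
  move: (k * (E - E')) (k * (F - F')) ((k - k') * E') ((k - k') * F') (2 * _ * (E + F))
    b11 b12 b21 b22 b31 b32 b41 b42 b51 b52 => ? ? ? ? ? *.
  by clearbody W Q; split; lra.
have NQ : `|N| <= 2 * Q.
  rewrite /N -mulrA normrM (ger0_norm k'0); apply: ler_pM => //.
  apply/ler_normlP; clear -EQ' FQ' E'0 F'0.
  by clearbody E' F' Q; split; lra.
rewrite profE -mulrBr normrM normrN (ger0_norm (ler0n _ 2)).
have := ratio_diff_le D1 dden dnum NQ etaB; move: (`|_ - _|) => y h.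
by clear -h; lra.
Qed.

Section limits.
Context (R : realType).
Notation tau := (@tower R).

Lemma cvg_le_harmonic (a : nat -> R) (c : R) :
  (\forall n \near \oo, 0 <= a n <= c * harmonic n) -> a @ \oo --> (0 : R).
Proof.
move=> H; have ch : c * harmonic n @[n --> \oo] --> (0 : R).
  rewrite -[X in _ --> X](mulr0 c).
  by apply: cvgM; [exact: cvg_cst|exact: cvg_harmonic].
exact: (squeeze_cvgr H (cvg_cst (0 : R)) ch).
Qed.

Lemma expRN_tower_cvg : expR (- (tau n / 2)) @[n --> \oo] --> (0 : R).
Proof.
apply: (@cvg_le_harmonic _ 2); apply: nearW => n; rewrite expR_ge0/= expRN.
rewrite -[2 * _]invrK invfM invrK lef_pV2 ?posrE ?expR_gt0//.
have := expR_ge1Dx (tau n / 2); have := tower_ge R n; rewrite -[n.+1%:R]natr1.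
by move=> h1 h2; lra.
Qed.

(** All the errors of a window are collected in one sequence eta tending to
    0, in terms of which the distance to the limiting profile is linear. *)
Lemma window_cvg (k_ : nat -> R) (k' p' X e : R) :
  0 <= k' <= 2 -> 0 <= p' -> 0 <= X -> 0 < e ->
  (\forall n \near \oo, 0 < k_ n <= 3 / 2 /\ (k_ n)^-1 <= tau n.+1) ->
  k_ n @[n --> \oo] --> k' -> window_weight n (k_ n) @[n --> \oo] --> p' ->
  \forall n \near \oo, forall x, `|x| <= X ->
    `|cole_hopf tau (window_time n.+1 (k_ n)) x - profile k' p' x| <= e.
Proof.
move=> k'I p'0 X0 e0 kI kcvg pcvg.
pose Q := expR (2 * X + X ^+ 2).
pose B := 2 + (2 * (X + X ^+ 2) + 1 + 2 * X) * Q.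
have Q0 : 0 < Q by exact: expR_gt0.
have B2 : 2 <= B.
  by rewrite /B lerDl mulr_ge0 ?(ltW Q0)//; have := sqr_ge0 X; lra.
pose sig n : R := k_ n / (8 * tau n.+1).
pose eta n : R := `|k_ n - k'| + `|window_weight n (k_ n) - p'| + sig n +
  window_weight n (k_ n) * tail_const X * expR (- (tau n / 2)).
have sig0 : sig n @[n --> \oo] --> (0 : R).
  apply: (@cvg_le_harmonic _ 1); near=> n.
  have [/andP[k0 k32] _] : 0 < k_ n <= 3 / 2 /\ (k_ n)^-1 <= tau n.+1 by near: n; exact: kI.
  have T2 := tower_ge R n.+1; have n0 : 0 <= n.+1%:R :> R by [].
  rewrite /sig; move: (tau n.+1) T2 => T T2; rewrite divr_ge0 ?(ltW k0)//=; last by lra.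
  have T0 : 0 < 8 * T by lra.
  rewrite mul1r ler_pdivrMr// mulrC ler_pdivlMr ?ltr0n//.
  by have : 0 < n.+1%:R :> R by []; nra.
have eta0 : eta n @[n --> \oo] --> (0 : R).
  have -> : (0 : R) = 0 + 0 + 0 + p' * tail_const X * 0 by rewrite mulr0 !addr0.
  apply: cvgD; first apply: cvgD; first apply: cvgD.
  - by apply/norm_cvg0P; apply/subr_cvg0.
  - by apply/norm_cvg0P; apply/subr_cvg0.
  - exact: sig0.
  - apply: cvgM; last exact: expRN_tower_cvg.
    by apply: cvgM => //; exact: cvg_cst.
pose d := Num.min (1 / (2 * B)) (e / (4 * (1 + 2 * Q) * B)).
have d0 : 0 < d by rewrite lt_min !divr_gt0// !mulr_gt0//; lra.
have /cvgrPdist_le /(_ d d0) etaH := eta0.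
have tail0 : 0 <= tail_const X.
  rewrite /tail_const !mulr_ge0 ?expR_ge0//.
  by apply: Rintegral_ge0 => j _; exact: expR_ge0.
near=> n => x xX.
have [/andP[k0 k32] kV] : 0 < k_ n <= 3 / 2 /\ (k_ n)^-1 <= tau n.+1 by near: n; exact: kI.
have etad : eta n <= d.
  have : `|0 - eta n| <= d by near: n; exact: etaH.
  by rewrite sub0r normrN; apply: le_trans; exact: ler_norm.
have [r0 [r1 [hr0 hr1 rE]]] := window_ratio k0 k32 kV xX.
rewrite /cole_hopf rE.
have a0 := normr_ge0 (k_ n - k'); have b0 := normr_ge0 (window_weight n (k_ n) - p').
have w0 : 0 <= window_weight n (k_ n) by rewrite divr_ge0 ?expR_ge0.
have s0 : 0 <= sig n.
  rewrite divr_ge0 ?(ltW k0)// mulr_ge0//.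
  by apply: le_trans (tower_ge2 R n.+1).
have t0 : 0 <= window_weight n (k_ n) * tail_const X * expR (- (tau n / 2)).
  by apply: mulr_ge0; [exact: mulr_ge0|exact: expR_ge0].
have etaB : eta n * B <= 1 / 2.
  apply: (@le_trans _ _ (d * B)); first by rewrite ler_wpM2r//; lra.
  rewrite -ler_pdivlMr; last by lra.
  by rewrite ge_min; apply/orP; left; rewrite !div1r invfM lexx.
apply: (@le_trans _ _ (4 * (1 + 2 * Q) * B * eta n)).
  apply: (@profile_estimate _ (k_ n) k' (window_weight n (k_ n)) p' (sig n) X x r0 r1 (eta n)) => //.
  - by rewrite (ltW k0)/=; lra.
  - by rewrite s0 /eta; lra.
  - by rewrite /eta; lra.
  - by rewrite /eta; lra.
  - by apply: le_trans hr0 _; rewrite /eta; lra.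
  - by apply: le_trans hr1 _; rewrite /eta; lra.
have K0 : 0 < 4 * (1 + 2 * Q) * B by rewrite !mulr_gt0//; lra.
rewrite mulrC -ler_pdivlMr//; apply: le_trans etad _.
by rewrite ge_min lexx orbT.
Unshelve. all: by end_near. Qed.

Lemma window_time_cvg (k_ : nat -> R) :
  (\forall n \near \oo, 0 < k_ n <= 3 / 2 /\ (k_ n)^-1 <= tau n.+1) ->
  window_time n.+1 (k_ n) @[n --> \oo] --> +oo.
Proof.
move=> kI; apply/cvgryPge => A; near=> n.
have [/andP[k0 k32] kV] : 0 < k_ n <= 3 / 2 /\ (k_ n)^-1 <= tau n.+1 by near: n; exact: kI.
have := window_time_ge n k0 k32; have := tower_ge R n.+1.
rewrite -[n.+1%:R]natr1; have : 3 * (A + 1) <= n%:R by near: n; exact: nbhs_infty_ger.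
by move: (tau n.+1) => T; lra.
Unshelve. all: by end_near. Qed.
End limits.

(** * Hyperbolic functions and viscous shocks *)

Section hyperbolic.
Context (R : realType).

Lemma cosh_ge1 (x : R) : 1 <= cosh x.
Proof.
have e1 : expR x * expR (- x) = 1 by rewrite -expRD subrr expR0.
have := expR_gt0 x; have := expR_gt0 (- x).
by rewrite /cosh; have := sqr_ge0 (expR x - expR (- x)); nra.
Qed.

Lemma normr_sinh_le_cosh (x : R) : `|sinh x| <= cosh x.
Proof.
have := expR_gt0 x; have := expR_gt0 (- x).
by rewrite /sinh /cosh => h1 h2; apply/ler_normlP; split; lra.
Qed.

Lemma is_derive_cosh (x : R) : is_derive x (1 : R) (@cosh R) (sinh x).
Proof.
have dN : is_derive x (1 : R) (fun y : R => - y) (-1) by apply: is_derive_eq.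
have d1 := is_derive1_comp (is_derive_expR (- x)) dN; rewrite /comp in d1.
by rewrite /cosh; apply: is_derive_eq; rewrite /sinh /GRing.scale/=; field.
Qed.

Lemma is_derive_sinh (x : R) : is_derive x (1 : R) (@sinh R) (cosh x).
Proof.
have dN : is_derive x (1 : R) (fun y : R => - y) (-1) by apply: is_derive_eq.
have d1 := is_derive1_comp (is_derive_expR (- x)) dN; rewrite /comp in d1.
by rewrite /sinh; apply: is_derive_eq; rewrite /cosh /GRing.scale/=; field.
Qed.

Lemma is_derive_tanh (x : R) : is_derive x (1 : R) (@tanh R) (1 - tanh x ^+ 2).
Proof.
have c0 : cosh x != 0 by rewrite gt_eqF// (lt_le_trans ltr01 (cosh_ge1 x)).
have ds := is_derive_sinh x; have dc := is_derive_cosh x.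
have dV := is_deriveV c0 dc.
by rewrite /tanh; apply: is_derive_eq; rewrite /GRing.scale/=; field.
Qed.

Lemma tanhN (x : R) : tanh (- x) = - tanh x.
Proof. by rewrite /tanh /sinh /cosh opprK [_ + expR x]addrC -mulNr -mulNr opprB. Qed.

Lemma tanh_gt0 (x : R) : 0 < x -> 0 < tanh x.
Proof.
move=> x0; rewrite divr_gt0//; last exact: lt_le_trans ltr01 (cosh_ge1 x).
by rewrite /sinh divr_gt0// subr_gt0 ltr_expR; lra.
Qed.

Lemma Psi1E (x : R) : Psi 1 x = - 2 * tanh (x / 2).
Proof.
have ex : expR x = expR (x / 2) ^+ 2 by rewrite expr2 -expRD; congr expR; field.
rewrite /Psi /tanh /sinh /cosh !expRN ex.
have e0 := expR_gt0 (x / 2); move: (expR (x / 2)) e0 => e e0; field.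
by apply/and3P; split; apply: lt0r_neq0; rewrite ?addr_gt0 ?mulr_gt0 ?exprn_gt0 ?mulr_gt0.
Qed.

Lemma phi_oppE (d : R) : phi d (- d) = profile (d / 2) 0.
Proof.
apply/funext => x; rewrite phi_opp /profile /tanh add0r.
by rewrite [d * x / 2]mulrAC mulrA; congr (_ / _); field.
Qed.

Lemma PsiE (gamma : R) : Psi gamma = profile 1 gamma.
Proof. by apply/funext => x; rewrite /Psi /profile !mul1r. Qed.

Lemma profile_Linfty (k p : R) : 0 <= k -> 0 <= p -> Linfty (profile k p).
Proof.
move=> k0 p0.
have den0 x : 0 < p + cosh (k * x) by have := cosh_ge1 (k * x); lra.
apply: (@bounded_Linfty _ _ (2 * k)).
  have ck : continuous (fun x : R => k * x).
    by move=> x; apply: continuousM => //; exact: cst_continuous.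
  have cs : continuous (fun x => sinh (k * x)).
    move=> x; apply: (continuous_comp (ck x)); apply: differentiable_continuous.
    by apply/derivable1_diffP; exact: (@ex_derive _ _ _ _ _ _ _ (is_derive_sinh _)).
  have cc : continuous (fun x => cosh (k * x)).
    move=> x; apply: (continuous_comp (ck x)); apply: differentiable_continuous.
    by apply/derivable1_diffP; exact: (@ex_derive _ _ _ _ _ _ _ (is_derive_cosh _)).
  move=> x; have dn : p + cosh (k * x) != 0 by rewrite gt_eqF.
  exact: (cvgM (cvgM (cvg_cst _) (cvgM (cvg_cst _) (cs x))) (cvgV dn (cvgD (cvg_cst _) (cc x)))).
move=> x; rewrite /profile normrM [`|_^-1|]ger0_norm ?invr_ge0 ?(ltW (den0 x))//.
rewrite ler_pdivrMr// normrM normrN (ger0_norm (ler0n _ 2)) (normrM k) (ger0_norm k0).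
rewrite mulrA ler_wpM2l ?mulr_ge0//.
by apply: le_trans (normr_sinh_le_cosh _) _; rewrite lerDr.
Qed.

(** Every translated shock solves 2 f' = (f - c)^2 - d^2.  For
    f (x) = -2 tanh (x/2), comparing this relation at 1 and at -1 with the one at 0
    gives v = - 2 c and v = 2 c for v = tanh (1/2), hence v = 0. *)
Lemma Psi1_notin_Sigma : ~ @Sigma R (Psi 1).
Proof.
move=> [beta [alpha [y [_ E]]]].
pose c := (alpha + beta) / 2; pose d := (beta - alpha) / 2.
pose T x := tanh (d * (x - y) / 2).
have EE x : - 2 * tanh (x / 2) = c - d * T x.
  by rewrite -Psi1E E /translate /phi -/c -/d.
have dL x : is_derive x (1 : R) (fun z => - 2 * tanh (z / 2)) (tanh (x / 2) ^+ 2 - 1).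
  have dh : is_derive x (1 : R) (fun z : R => z / 2) (1 / 2).
    by apply: is_derive_eq; rewrite /GRing.scale/=; ring.
  have dt := @is_derive1_comp _ (@tanh R) (fun z => z / 2) _ _ _ (is_derive_tanh _) dh.
  by rewrite /comp in dt; apply: is_derive_eq; rewrite /GRing.scale/=; field.
have dR x : is_derive x (1 : R) (fun z => c - d * T z) (- (d ^+ 2 / 2) * (1 - T x ^+ 2)).
  have dh : is_derive x (1 : R) (fun z : R => d * (z - y) / 2) (d / 2).
    by apply: is_derive_eq; rewrite /GRing.scale/=; ring.
  have dt := @is_derive1_comp _ (@tanh R) (fun z => d * (z - y) / 2) _ _ _ (is_derive_tanh _) dh.
  by rewrite /comp in dt; apply: is_derive_eq; rewrite /T /GRing.scale/=; field.
have ode x : tanh (x / 2) ^+ 2 - 1 = - (d ^+ 2 / 2) * (1 - T x ^+ 2).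
  rewrite -(@derive_val _ _ _ _ _ _ _ (dL x)) -(@derive_val _ _ _ _ _ _ _ (dR x)).
  by congr ('D_1 _ x); apply/funext => z; exact: EE.
have quad x : tanh (x / 2) ^+ 2 - 1 = ((- 2 * tanh (x / 2) - c) ^+ 2 - d ^+ 2) / 2.
  by rewrite ode EE; field.
have v0 : 0 < tanh (1 / 2) :> R by apply: tanh_gt0.
have q0 := quad 0; have q1 := quad 1; have q2 := quad (-1).
have t0 : tanh (0 : R) = 0 by rewrite /tanh /sinh oppr0 subrr mul0r mul0r.
have n2 : -1 / 2 = - (1 / 2) :> R by rewrite mulNr.
rewrite mul0r t0 in q0; rewrite n2 tanhN in q2.
move: q0 q1 q2; move: (tanh (1 / 2)) v0 => v v0 q0 q1 q2.
clear -v0 q0 q1 q2; have vv : 0 < v * v by exact: mulr_gt0.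
lra.
Qed.
End hyperbolic.

(** * The omega-limit set *)

Section omega_limit.
Context (R : realType).
Notation tau := (@tower R).

Definition datum : R -> R := cole_hopf tau 0.

Lemma burgers_flow_datum (t : R) : 0 < t -> burgers_flow datum t = cole_hopf tau t.
Proof.
move=> t0; have sol := cole_hopf_solution (@tower_ge R).
apply/funext => x; apply: (@burgers_unique _ datum) => //.
exact: (@xgetPex _ (fun _ _ => 0) [set u | burgers_solution datum u] (ex_intro _ _ sol)).
Qed.

(** Uniqueness replaces the chosen solution by the explicit one, and the
    window times tend to infinity. *)
Lemma profile_in_omega0 (k_ : nat -> R) (k' p' : R) :
  0 <= k' <= 2 -> 0 <= p' ->
  (\forall n \near \oo, 0 < k_ n <= 3 / 2 /\ (k_ n)^-1 <= tau n.+1) ->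
  k_ n @[n --> \oo] --> k' -> window_weight n (k_ n) @[n --> \oo] --> p' ->
  omega0 datum (profile k' p').
Proof.
move=> k'I p'0 kI kcvg pcvg; split.
  by apply: profile_Linfty => //; case/andP: k'I.
exists (fun n => window_time n.+1 (k_ n)); split; first exact: window_time_cvg.
move=> a b U /uniform_nbhs[V [entV sub]].
have [e /= e0 Ve] : exists2 e : R, 0 < e & [set xy : R * R | `|xy.1 - xy.2| < e] `<=` V.
  by move: entV; rewrite -entourage_ballE => -[e /= e0 H]; exists e.
pose X := Num.max `|a| `|b|.
have X0 : 0 <= X by rewrite le_max normr_ge0.
have e20 : 0 < e / 2 by rewrite divr_gt0.
have H := window_cvg k'I p'0 X0 e20 kI kcvg pcvg.
have tcvg : \forall n \near \oo, 0 < window_time n.+1 (k_ n).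
  by have /cvgryPgt := window_time_cvg kI; apply.
near=> n; apply: sub => y /=; rewrite in_itv/= => /andP[ay yb].
have tn : 0 < window_time n.+1 (k_ n) by near: n; exact: tcvg.
have Hn : forall x, `|x| <= X ->
    `|cole_hopf tau (window_time n.+1 (k_ n)) x - profile k' p' x| <= e / 2.
  by near: n; exact: H.
apply: Ve => /=; rewrite burgers_flow_datum// distrC.
apply: (@le_lt_trans _ _ (e / 2)); last by lra.
apply: Hn; rewrite /X le_max; have [y0|y0] := leP 0 y.
  by apply/orP; right; rewrite ger0_norm//; apply: le_trans yb (ler_norm b).
apply/orP; left; rewrite ltr0_norm//; apply: le_trans (_ : - a <= _); first by rewrite lerN2.
by rewrite -normrN ler_norm.
Unshelve. all: by end_near. Qed.

Lemma tower_large n : 8 * n.+1%:R <= tau n.+1 * harmonic n.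
Proof.
have n0 : 0 < n.+1%:R :> R by [].
have nS : n%:R + 1 = n.+1%:R :> R by rewrite natr1.
have hS := tower_ge R n; have := tower_sqr R n.
have -> : tau n.+1 * harmonic n = tau n.+1 / n.+1%:R by [].
rewrite ler_pdivlMr// => hT; apply: le_trans hT.
by move: (tau n) hS => S hS; rewrite -nS in n0 *; nra.
Qed.

Lemma phi_in_omega0 (d : R) : 0 <= d <= 2 -> omega0 datum (phi d (- d)).
Proof.
move=> /andP[d0 d2]; rewrite phi_oppE; pose k' := d / 2.
pose e n : R := harmonic n.
(* The convex combination with 1/2 keeps k_n at distance e_n / 2 from 0 and 1, so
   that the end points of the range of delta are reached as limits too:
   1 / k_n stays below tau_(n+1), and tau_(n+1) (1 - k_n) tends to infinity. *)
pose k_ n := (1 - e n) * k' + e n / 2.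
have k'0 : 0 <= k' by rewrite divr_ge0.
have k'1 : k' <= 1 by rewrite ler_pdivrMr// mul1r.
have e_gt0 n : 0 < e n by rewrite /e/= invr_gt0.
have e_le1 n : e n <= 1 by rewrite /e/= invf_le1// ler1n.
have k_low n : e n / 2 <= k_ n.
  by rewrite /k_ lerDr mulr_ge0// subr_ge0.
have k_up n : k_ n <= 1 - e n / 2 by rewrite /k_; have := e_le1 n; have := e_gt0 n; nra.
have k_gt0 n : 0 < k_ n by apply: lt_le_trans (k_low n); rewrite divr_gt0.
have kV n : (k_ n)^-1 <= 2 * n.+1%:R.
  have -> : 2 * n.+1%:R = (e n / 2)^-1 by rewrite invfM invrK /e/= invrK mulrC.
  by rewrite lef_pV2 ?posrE// divr_gt0.
apply: (@profile_in_omega0 k_).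
- by apply/andP; split => //; lra.
- by [].
- apply: nearW => n; split.
    by rewrite k_gt0/=; have := k_up n; have := e_gt0 n; lra.
  apply: le_trans (kV n) _; have := tower_ge R n; have := tower_sqr R n.
  have n0 : 0 <= n%:R :> R by [].
  by rewrite -[n.+1%:R]natr1; nra.
- rewrite -/k'; have -> : k' = (1 - 0) * k' + 0 / 2 by rewrite subr0 mul1r mul0r addr0.
  have ce : e n @[n --> \oo] --> (0 : R) by exact: cvg_harmonic.
  apply: cvgD; apply: cvgM; [|exact: cvg_cst|exact: ce|exact: cvg_cst].
  by apply: cvgB => //; exact: cvg_cst.
- apply: (@cvg_le_harmonic _ _ 1); apply: nearW => n.
  have w0 : 0 < window_weight n (k_ n) by rewrite divr_gt0 ?expR_gt0.
  rewrite (ltW w0)/= mul1r.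
  have n0 : 0 < n.+1%:R :> R by [].
  pose a := 2 * tau n.+1 * (1 - k_ n) + ln (k_ n / 2) / 2.
  have lnk : - ln (k_ n / 2) <= 4 * n.+1%:R.
    rewrite -lnV ?posrE ?divr_gt0// invfM invrK.
    have kp : 0 < (k_ n)^-1 * 2 by rewrite mulr_gt0 ?invr_gt0.
    have := @le_ln1Dx _ ((k_ n)^-1 * 2 - 1).
    rewrite [1 + _]addrC subrK => /(_ ltac:(lra)).
    by have := kV n; lra.
  have Te : 8 * n.+1%:R <= tau n.+1 * e n by exact: tower_large.
  have ha : n.+1%:R <= a.
    have : tau n.+1 * e n <= 2 * tau n.+1 * (1 - k_ n).
      have := k_up n; have := tower_ge2 R n.+1; move: (tau n.+1) => T; nra.
    by rewrite /a; lra.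
  rewrite /window_weight -/a expRN.
  have ea := expR_ge1Dx a.
  have : (expR a)^-1 <= n.+1%:R^-1 by rewrite lef_pV2 ?posrE ?expR_gt0//; lra.
  have : 0 < (expR a)^-1 by rewrite invr_gt0 expR_gt0.
  by rewrite /=; move: ((expR a)^-1) (n.+1%:R^-1) => z m; lra.
Qed.

Lemma Psi_in_omega0 (g : R) : 0 < g -> omega0 datum (Psi g).
Proof.
move=> g0; rewrite PsiE.
(* With this k_n the quantity 2 tau_(n+1) (1 - k_n) is the constant s, and the
   weights converge to exp (- s - ln (1/2) / 2) / 2, which s makes equal to g. *)
pose s := ln 2 / 2 - ln (2 * g).
pose k_ n := 1 - s / (2 * tau n.+1).
have tau0 n : 0 < 2 * tau n.+1 by have := tower_ge2 R n.+1; lra.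
have q0 : s / (2 * tau n.+1) @[n --> \oo] --> (0 : R).
  apply/norm_cvg0P; apply: (@cvg_le_harmonic _ _ `|s|); apply: nearW => n.
  rewrite normr_ge0 andTb normrM ler_wpM2l//.
  rewrite ger0_norm ?invr_ge0 ?(ltW (tau0 n))// lef_pV2 ?posrE//.
  by have := tower_ge R n.+1; have := tower_ge2 R n.+1; lra.
have kcvg : k_ n @[n --> \oo] --> (1 : R).
  by rewrite -[X in _ --> X]subr0; apply: cvgB => //; exact: cvg_cst.
apply: (@profile_in_omega0 k_) => //.
- by rewrite ler01 ler1n.
- exact: ltW.
- have /cvgrPdist_le /(_ (1 / 2)) := kcvg; rewrite divr_gt0// => /(_ isT).
  apply: filterS => n /ler_normlP[h1 h2]; have k0 : 0 < k_ n by lra.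
  split; first by rewrite k0/=; lra.
  apply: (@le_trans _ _ 2); last exact: tower_ge2.
  rewrite -[leRHS]invrK lef_pV2 ?posrE ?invr_gt0//; lra.
- have wE n : window_weight n (k_ n) = expR (- (s + ln (k_ n / 2) / 2)) / 2.
    have kE : 2 * tau n.+1 * (1 - k_ n) = s.
      by rewrite /k_ opprB addrC subrK mulrC divfK// gt_eqF// tau0.
    by rewrite /window_weight kE.
  have gE : g = expR (- (s + ln (1 / 2) / 2)) / 2.
    rewrite /s div1r lnV ?posrE//.
    have -> : - (ln 2 / 2 - ln (2 * g) + - ln 2 / 2) = ln (2 * g) by ring.
    by rewrite lnK ?posrE ?mulr_gt0// mulrC mulKf.
  rewrite (funext wE) gE.
  apply: cvgM; last exact: cvg_cst.
  apply: continuous_cvg; first exact: continuous_expR.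
  apply: cvgN; apply: cvgD; first exact: cvg_cst.
  apply: cvgM; last exact: cvg_cst.
  apply: continuous_cvg; first by apply: continuous_ln; rewrite divr_gt0.
  by apply: cvgM => //; exact: cvg_cst.
Qed.
End omega_limit.

Theorem proposition6p2 (R : realType) :
  exists u0 : R -> R,
    [/\ Linfty u0,
        [set Psi gamma | gamma in [set gamma : R | 0 < gamma]] `|`
        [set phi delta (- delta) | delta in `[0, 2]] `<=` omega0 u0 &
        ~ (omega0 u0 `<=` @Sigma R)].
Proof.
have [M _ HM] := cole_hopf_bounded (@tower_ge R).
exists (@datum R); split.
- apply: (@bounded_Linfty _ _ M) => [|x].
    by apply: cole_hopf_continuous; [exact: tower_ge|exact: ltrN10].
  exact: HM (ltrN10 _).
- move=> v [[g g0 <-]|[d dI <-]]; first exact: Psi_in_omega0.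
  by apply: phi_in_omega0; move: dI; rewrite /= in_itv.
- by move=> sub; apply: (@Psi1_notin_Sigma R); apply: sub; apply: Psi_in_omega0.
Qed.
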